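(* Let $\mu,\upsilon>-1$, $0<\rho\le 1$, and let $k,r$ be integers with $0\le k\le r$. Then the transformed derivatives of the fractional backward orthogonal functions satisfy $$\mathcal{D}_\rho^k\mathcal{P}_r^{\mu,\upsilon,\rho}(t)=\widehat d_{r,k}^{\mu,\upsilon}\,\mathcal{P}_{r-k}^{\mu+k,\upsilon+k,\rho}(t),\qquad \widehat d_{r,k}^{\mu,\upsilon}=\frac{\Gamma(r+k+\mu+\upsilon+1)}{\Gamma(r+\mu+\upsilon+1)}.$$ Moreover, these derivatives are orthogonal with respect to the weight $\varkappa^{\mu+k,\upsilon+k,\rho}$: for every integer $s\ge 0$, $$\int_0^1\varkappa^{\mu+k,\upsilon+k,\rho}(t)\,\mathcal{D}_\rho^k\mathcal{P}_r^{\mu,\upsilon,\rho}(t)\,\mathcal{D}_\rho^k\mathcal{P}_s^{\mu,\upsilon,\rho}(t)\,dt=\widehat h_{r,k}^{\mu,\upsilon}\,\delta_{s,r},$$ with $$\widehat h_{r,k}^{\mu,\upsilon}=\frac{\Gamma(r+\mu+1)\,\Gamma(r+\upsilon+1)\,\Gamma(r+k+\mu+\upsilon+1)}{(2r+\mu+\upsilon+1)\,(r-k)!\,\Gamma^2(r+\mu+\upsilon+1)}.$$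
   Context: For $\mu,\upsilon>-1$, $\mathcal{P}_r^{\mu,\upsilon}$ is the classical Jacobi polynomial of degree $r$ on $[-1,1]$ (orthogonal with respect to $(1-x)^\mu(1+x)^\upsilon$, standard normalization $\mathcal{P}_r^{\mu,\upsilon}(1)=\Gamma(r+\mu+1)/(r!\,\Gamma(\mu+1))$). The fractional backward orthogonal functions are $\mathcal{P}_r^{\mu,\upsilon,\rho}(t)=\mathcal{P}_r^{\mu,\upsilon}(1-2(1-t)^\rho)$ for $t\in J=[0,1]$. The backward transformed derivative is $\mathcal{D}_\rho f(t)=\frac{(1-t)^{1-\rho}}{\rho}f'(t)$, i.e. the derivative with respect to $\eta=1-(1-t)^\rho$; $\mathcal{D}_\rho^k$ is its $k$-fold composition, $\mathcal{D}_\rho^0$ being the identity. The weight is $\varkappa^{\mu,\upsilon,\rho}(t)=\rho(1-t)^{\rho(\mu+1)-1}\bigl(1-(1-t)^\rho\bigr)^\upsilon$. $\delta_{s,r}$ is the Kronecker delta. In the degenerate case $r=k=0$, $\mu+\upsilon+1=0$ the constants are read by continuity: $\widehat d_{0,0}^{\mu,\upsilon}=1$ and $\widehat h_{0,0}^{\mu,\upsilon}=\Gamma(\mu+1)\Gamma(\upsilon+1)/\Gamma(\mu+\upsilon+2)$. *)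

(* Defs.v *)
From HB Require Import structures.
From mathcomp Require Import all_boot all_order all_algebra.
From mathcomp Require Import all_classical all_reals all_analysis.

Set Implicit Arguments.
Unset Strict Implicit.
Unset Printing Implicit Defensive.

Import Order.TTheory GRing.Theory Num.Theory.
Import numFieldNormedType.Exports.

Local Open Scope classical_set_scope.
Local Open Scope ring_scope.

(* Only meaningful for 0 < x. *)
Definition euler_gamma (R : realType) (x : R) : R :=
  \int[@lebesgue_measure R]_(t in `]0, +oo[) (t `^ (x - 1) * expR (- t)).

(* Euler's integral for 0 < x, extended to x <= 0 by
   Gamma(x) = Gamma(x + n) / (x (x + 1) ... (x + n - 1)), where n is the least
   natural number with 0 < x + n. The value at the poles 0, -1, -2, ... is 0
   (inverse of zero). *)
Definition Gamma (R : realType) (x : R) : R :=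
  let n := if 0 < x then 0%N else (Num.truncn (- x)).+1 in
  euler_gamma (x + n%:R) / \prod_(i < n) (x + i%:R).

Definition jacobi_weight (R : realType) (mu ups x : R) : R :=
  (1 - x) `^ mu * (1 + x) `^ ups.

(* The integral is extended-real valued, so that its being equal to 0 entails
   that it converges. *)
Definition is_jacobi_system (R : realType) (mu ups : R)
    (P : nat -> {poly R}) : Prop :=
  [/\ forall r, size (P r) = r.+1,
      forall r s, r <> s ->
        (\int[@lebesgue_measure R]_(x in `[(-1)%R, 1%R])
           (jacobi_weight mu ups x * (P r).[x] * (P s).[x])%:E = 0)%E
    & forall r, (P r).[1] = Gamma (r%:R + mu + 1) / ((r`!)%:R * Gamma (mu + 1))].

(* For -1 < mu, ups the three conditions determine the system. *)
Definition jacobi (R : realType) (mu ups : R) : nat -> {poly R} :=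
  xget (fun=> 0) [set P | is_jacobi_system mu ups P].

Definition fjacobi (R : realType) (mu ups rho : R) (r : nat) (t : R) : R :=
  (jacobi mu ups r).[1 - 2 * (1 - t) `^ rho].

Definition eta (R : realType) (rho t : R) : R := 1 - (1 - t) `^ rho.

Definition quotient_wrt (R : realType) (g f : R -> R) (t s : R) : R :=
  (f s - f t) / (g s - g t).

(* Punctured neighbourhoods of t in J = [0, 1]: the derivatives below are
   one-sided at the endpoints, and only involve the values of f on J. *)
Definition punctured_in_J (R : realType) (t : R) : set_system R :=
  within `[0, 1] t^'.

Definition derivable_wrt (R : realType) (g f : R -> R) (t : R) : Prop :=
  cvg (quotient_wrt g f t s @[s --> punctured_in_J t]).

Definition derive_wrt (R : realType) (g f : R -> R) (t : R) : R :=
  lim (quotient_wrt g f t s @[s --> punctured_in_J t]).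

(* At t = 1 the formula (1 - t)^(1 - rho) / rho * f'(t) may be of the form
   0 * oo (e.g. for f = eta rho with rho < 1); there the operator is the
   derivative with respect to eta, with which the formula agrees for t < 1. *)
Definition tderive (R : realType) (rho : R) (f : R -> R) (t : R) : R :=
  if t < 1 then (1 - t) `^ (1 - rho) / rho * derive_wrt id f t
  else derive_wrt (eta rho) f t.

Definition tderivable (R : realType) (rho : R) (f : R -> R) (t : R) : Prop :=
  if t < 1 then derivable_wrt id f t else derivable_wrt (eta rho) f t.

Definition tderiven (R : realType) (rho : R) (k : nat) (f : R -> R) : R -> R :=
  iter k (tderive rho) f.

Definition varkappa (R : realType) (mu ups rho t : R) : R :=
  rho * (1 - t) `^ (rho * (mu + 1) - 1) * (1 - (1 - t) `^ rho) `^ ups.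

(* In the degenerate case r = k = 0, mu + ups + 1 = 0 the general formulas for
   dhat and hhat hit a pole of Gamma; the values there are their limits. *)
Definition dhat (R : realType) (mu ups : R) (r k : nat) : R :=
  if [&& r == 0%N, k == 0%N & mu + ups + 1 == 0] then 1
  else Gamma (r%:R + k%:R + mu + ups + 1) / Gamma (r%:R + mu + ups + 1).

Definition hhat (R : realType) (mu ups : R) (r k : nat) : R :=
  if [&& r == 0%N, k == 0%N & mu + ups + 1 == 0] then
    Gamma (mu + 1) * Gamma (ups + 1) / Gamma (mu + ups + 2)
  else
    Gamma (r%:R + mu + 1) * Gamma (r%:R + ups + 1)
      * Gamma (r%:R + k%:R + mu + ups + 1)
    / ((2 * r%:R + mu + ups + 1) * ((r - k)`!)%:R
       * Gamma (r%:R + mu + ups + 1) ^+ 2).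

(* Main.v *)
(* In the variable y = 1 - eta = (1 - t)^rho the operator D_rho is - d/dy, and the
   Jacobi polynomials become polynomials on [0, 1] for the weight
   y^(a - 1) (1 - y)^(b - 1), with a = mu + 1 and b = ups + 1. They are built by
   the Rodrigues recursion (r + 1) P_{r+1}^{a,b} = A P_r^{a+1,b+1}, where
   A q = y (1 - y) q' + (a - (a + b) y) q is minus the adjoint of d/dy between the
   two weighted spaces. Commuting d/dy with A gives
   (P_{r+1}^{a,b})' = - (r + a + b) P_r^{a+1,b+1}, and adjointness gives
   orthogonality and a recursion for the norms, all of which only uses the moments
   B(a + n, b) of the weight. Those come from Euler's identity
   Gamma(a) Gamma(b) = Gamma(a + b) B(a, b), proved by Tonelli; its case b = 1 is
   the functional equation of Gamma. *)

Require Import Defs.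
From HB Require Import structures.
From mathcomp Require Import all_boot all_order all_algebra.
From mathcomp Require Import all_classical all_reals all_analysis.
From mathcomp Require Import measurable_realfun ring lra.
From mathcomp.real_closed Require polyorder.

Import Order.TTheory GRing.Theory Num.Theory.
Import numFieldNormedType.Exports.

Local Open Scope classical_set_scope.
Local Open Scope ring_scope.

Set Implicit Arguments.
Unset Strict Implicit.

(** * Change of variables *)

(** The segments [1/(n + 1), n + 1] exhaust ]0, +oo[ and their preimages under F exhaust A.
    Substitution on each segment and monotone convergence on both sides give the identity, in which
    both integrals may be +oo. *)
Lemma ge0_integration_by_substitution_gt0 (R : realType) (A : set R)
    (F f G : R -> R) :
  open A -> is_interval A ->
  {in A &, {homo F : x y / x < y}} ->
  (forall x, A x -> is_derive x 1 F (f x)) ->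
  (forall x, A x -> {for x, continuous f}) ->
  (forall x, A x -> 0 < F x) ->
  (forall v : R, 0 < v -> exists2 x, A x & F x = v) ->
  (forall v : R, 0 < v -> {for v, continuous G}) ->
  (forall v : R, 0 < v -> 0 <= G v) ->
  (\int[@lebesgue_measure R]_(v in `]0%R, +oo[) (G v)%:E =
   \int[@lebesgue_measure R]_(x in A) (G (F x) * f x)%:E)%E.
Proof.
move=> oA iA incF dF cf F0 sF cG G0.
have /choice[h hP] (n : nat) :
    exists ab : R * R, [/\ A ab.1, A ab.2, F ab.1 = n.+1%:R^-1 & F ab.2 = n.+1%:R].
  have [x Ax Fx] := sF n.+1%:R^-1 ltac:(by rewrite invr_gt0).
  have [y Ay Fy] := sF n.+1%:R ltac:(by []).
  by exists (x, y).
pose a n := (h n).1; pose b n := (h n).2.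
have Aa n : A (a n) by have [] := hP n.
have Ab n : A (b n) by have [] := hP n.
have Fa n : F (a n) = n.+1%:R^-1 by have [] := hP n.
have Fb n : F (b n) = n.+1%:R by have [] := hP n.
have lF x y : A x -> A y -> (F x <= F y) = (x <= y).
  move=> Ax Ay; apply/idP/idP; last first.
    rewrite le_eqVlt => /predU1P[->//|xy].
    by apply/ltW/incF => //; rewrite inE.
  by apply: contraTT; rewrite -!ltNge => ?; apply: incF => //; rewrite inE.
have sub n x : x \in `[a n, b n] -> A x.
  by rewrite in_itv/= => /iA; exact.
have cF x : A x -> {for x, continuous F}.
  by move=> /dF ?; apply/differentiable_continuous/derivable1_diffP.
(* Since A is open, [derive1 F] coincides with f near each point of A, hence inherits its
   continuity. *)
have nF x : A x -> \forall y \near x, derive1 F y = f y.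
  move=> Ax; near=> y; rewrite derive1E; apply: derive_val.
  by apply: dF; near: y; exact: open_nbhs_nbhs.
have cF' x : A x -> {for x, continuous (derive1 F)}.
  move=> Ax; rewrite /prop_for /continuous_at (nbhs_singleton (nF x Ax)).
  apply: cvg_trans (cf x Ax); apply: near_eq_cvg.
  by near=> y; apply/esym; near: y; exact: nF.
have f0 x : A x -> 0 <= f x.
  move=> Ax; rewrite -(nbhs_singleton (nF x Ax)).
  have iAE : interior A = A by apply/interior_id.
  apply: (@incr_derive1_ge0 _ _ A); rewrite ?iAE//.
  by move=> y /set_mem/dF ?; exact: ex_derive.
have seg n : (\int[@lebesgue_measure R]_(v in `[(n.+1%:R : R)^-1%R, (n.+1%:R : R)%R]) (G v)%:E =
    \int[@lebesgue_measure R]_(x in `[a n, b n]) (G (F x) * f x)%:E)%E.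
  rewrite -Fa -Fb integration_by_substitution_increasing.
  - apply: eq_integral => x; rewrite inE/= => /sub Ax.
    by rewrite !fctE (nbhs_singleton (nF x Ax)).
  - rewrite -lF// Fa Fb (@le_trans _ _ 1)// ?invf_le1 ?ler1n//.
  - by move=> x y /sub Ax /sub Ay; apply: incF; rewrite inE.
  - move=> x xab; apply/cF'/(sub n).
    exact: subset_itv_oo_cc xab.
  - by apply/cvg_ex; exists ((derive1 F) (a n)); apply: cvg_at_right_filter; exact: cF'.
  - by apply/cvg_ex; exists ((derive1 F) (b n)); apply: cvg_at_left_filter; exact: cF'.
  - split.
    + move=> x xab; have /dF ? : A x by apply/(sub n); exact: subset_itv_oo_cc xab.
      exact: ex_derive.
    + by apply: cvg_at_right_filter; exact: cF.
    + by apply: cvg_at_left_filter; exact: cF.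
  - apply: continuous_in_subspaceT => v; rewrite inE/= in_itv/= Fa => /andP[av _].
    by apply: cG; rewrite (lt_le_trans _ av)// invr_gt0.
have natge (x : R) : exists n : nat, x <= n.+1%:R.
  exists (Num.truncn x); exact/ltW/truncnS_gt.
have U1 : `](0:R), +oo[%classic = \bigcup_n `[(n.+1%:R : R)^-1, n.+1%:R]%classic.
  apply/seteqP; split => v /=; rewrite in_itv/= ?andbT.
    move=> v0; have [n nv] := natge (Num.max v v^-1).
    exists n => //=; rewrite in_itv/=; move: nv; rewrite ge_max => /andP[-> nv].
    by rewrite andbT -[v]invrK lef_pV2// ?posrE ?invr_gt0.
  by move=> [n _]; rewrite /= in_itv/= => /andP[nv _]; rewrite (lt_le_trans _ nv)// invr_gt0.
have U2 : A = \bigcup_n `[a n, b n]%classic.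
  apply/seteqP; split => x /=; last by move=> [n _]; exact: sub.
  move=> Ax; have [n nv] := natge (Num.max (F x) (F x)^-1).
  exists n => //=; rewrite in_itv/= -(lF _ _ (Aa n) Ax) -(lF _ _ Ax (Ab n)) Fa Fb.
  move: nv; rewrite ge_max => /andP[-> nv].
  by rewrite andbT -[F x]invrK lef_pV2// ?posrE ?invr_gt0 ?F0.
have nd1 : nondecreasing_seq (fun n => `[(n.+1%:R : R)^-1, n.+1%:R]%classic).
  apply/nondecreasing_seqP => n; apply/subsetPset => x /=; rewrite !in_itv/=.
  move=> /andP[h1 h2]; apply/andP; split.
    by rewrite (le_trans _ h1)// lef_pV2 ?posrE// ler_nat.
  by rewrite (le_trans h2)// ler_nat.
have nd2 : nondecreasing_seq (fun n => `[a n, b n]%classic).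
  apply/nondecreasing_seqP => n; apply/subsetPset => x xn; have Ax := sub _ _ xn.
  move: xn; rewrite /= !in_itv/= -!(lF _ _ (Aa _) Ax) -!(lF _ _ Ax (Ab _)) !Fa !Fb.
  move=> /andP[h1 h2]; apply/andP; split.
    by rewrite (le_trans _ h1)// lef_pV2 ?posrE// ler_nat.
  by rewrite (le_trans h2)// ler_nat.
have mA : measurable A by exact: open_measurable.
have mG : measurable_fun `](0 : R), +oo[ (EFin \o G).
  apply/measurable_EFinP; apply: open_continuous_measurable_fun => //.
  by move=> v; rewrite inE/= in_itv/= andbT; exact: cG.
have mGF : measurable_fun A (fun x => (G (F x) * f x)%:E).
  apply/measurable_EFinP; apply: open_continuous_measurable_fun => // x.
  rewrite inE => Ax; apply: continuousM; last exact: cf.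
  by apply: continuous_comp; [exact: cF|apply: cG; exact: F0].
have cL : (\int[@lebesgue_measure R]_(x in `[a n, b n]) (G (F x) * f x)%:E)%E
    @[n --> \oo] --> (\int[@lebesgue_measure R]_(v in `]0%R, +oo[) (G v)%:E)%E.
  under eq_fun do rewrite -seg.
  rewrite U1; apply: (@ge0_nondecreasing_set_cvg_integral _ (measurableTypeR R) R
    _ (EFin \o G) lebesgue_measure nd1) => n.
  - exact: measurable_itv.
  - apply: measurable_funS mG => // v nv; rewrite U1; by exists n.
  - move=> v /=; rewrite in_itv/= => /andP[av _].
    by rewrite lee_fin G0// (lt_le_trans _ av)// invr_gt0.
have cR : (\int[@lebesgue_measure R]_(x in `[a n, b n]) (G (F x) * f x)%:E)%E
    @[n --> \oo] --> (\int[@lebesgue_measure R]_(x in A) (G (F x) * f x)%:E)%E.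
  rewrite [in X in _ --> X]U2; apply: (@ge0_nondecreasing_set_cvg_integral _
    (measurableTypeR R) R _ (fun x => (G (F x) * f x)%:E) lebesgue_measure nd2) => n.
  - exact: measurable_itv.
  - by apply: measurable_funS mGF => // x; exact: sub.
  - by move=> x /sub Ax; rewrite lee_fin mulr_ge0 ?f0// G0// F0.
by apply: (cvg_unique _ cL cR); exact: ereal_hausdorff.
Unshelve. all: by end_near. Qed.

(** Extension by zero outside the rectangle reduces this to Tonelli on the plane. *)
Lemma fubini_tonelli_setX (R : realType) (A B : set R) (f : R * R -> \bar R) :
  measurable A -> measurable B -> measurable_fun setT f ->
  (forall z, 0 <= f z)%E ->
  (\int[@lebesgue_measure R]_(x in A) \int[@lebesgue_measure R]_(y in B) f (x, y) =
   \int[@lebesgue_measure R]_(y in B) \int[@lebesgue_measure R]_(x in A) f (x, y))%E.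
Proof.
move=> mA mB mf f0; pose g := f \_ (A `*` B).
have gE x y : g (x, y) = if (x \in A) && (y \in B) then f (x, y) else 0%E.
  by rewrite /g patchE in_setX.
have mg : measurable_fun setT g.
  apply/(measurable_restrictT f); first exact: measurableX.
  exact: measurable_funTS.
transitivity (\int[@lebesgue_measure R]_x \int[@lebesgue_measure R]_y g (x, y))%E.
  rewrite integral_mkcond; apply: eq_integral => x _; rewrite patchE.
  case: ifPn => xA; last by rewrite integral0_eq// => y _; rewrite gE (negbTE xA).
  by rewrite integral_mkcond; apply: eq_integral => y _; rewrite patchE gE xA.
transitivity (\int[@lebesgue_measure R]_y \int[@lebesgue_measure R]_x g (x, y))%E.
  apply: (@fubini_tonelli _ _ (measurableTypeR R) (measurableTypeR R) R
    lebesgue_measure lebesgue_measure g) => //.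
  by move=> [x y]; rewrite gE; case: ifP.
symmetry; rewrite integral_mkcond; apply: eq_integral => y _; rewrite patchE.
case: ifPn => yB; last by rewrite integral0_eq// => x _; rewrite gE (negbTE yB) andbF.
by rewrite integral_mkcond; apply: eq_integral => x _; rewrite patchE gE yB andbT.
Qed.

(** Extended-real valued, so that Tonelli and comparison apply before finiteness is known. *)
Definition gamma_integral (R : realType) (x : R) : \bar R :=
  (\int[@lebesgue_measure R]_(t in `]0%R, +oo[) (t `^ (x - 1) * expR (- t))%:E)%E.

(* The substitution v = y^-1 - 1 turns this into the Beta integral over y in ]0, 1[. *)
Definition beta_integral (R : realType) (a b : R) : \bar R :=
  (\int[@lebesgue_measure R]_(v in `]0%R, +oo[)
     (v `^ (b - 1) * (1 + v) `^ (- (a + b)))%:E)%E.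

Lemma continuous_powR (R : realType) (p x : R) : 0 < x ->
  {for x, continuous (@powR R ^~ p)}.
Proof.
move=> x0; apply/differentiable_continuous/derivable1_diffP.
by apply: derivable_powR; rewrite in_itv/= x0.
Qed.

Lemma gt0_mulr_powRB1 (R : realType) (p x : R) : 0 < x ->
  x * x `^ (p - 1) = x `^ p.
Proof.
move=> x0; rewrite -{1}(powRr1 (ltW x0)) -powRD ?(gt_eqF x0) ?implybT//.
by rewrite addrC subrK.
Qed.

Lemma gamma_integral_scale (R : realType) (s c : R) : 0 < c ->
  gamma_integral s = ((c `^ s)%:E *
    \int[@lebesgue_measure R]_(x in `]0%R, +oo[) (x `^ (s - 1) * expR (- (c * x)))%:E)%E.
Proof.
move=> c0.
have mf : measurable_fun `](0 : R), +oo[ (fun x => (x `^ (s - 1) * expR (- (c * x)))%:E).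
  apply/measurable_EFinP/measurable_funM.
    by apply: measurable_funTS; exact: measurable_powR.
  by apply: measurable_funTS; apply: measurableT_comp => //; apply: measurableT_comp.
rewrite -ge0_integralZl ?lee_fin ?powR_ge0//; last first.
  by move=> x _; rewrite lee_fin mulr_ge0 ?powR_ge0 ?expR_ge0.
have dF (x : R) : `]0, +oo[%classic x -> is_derive x 1 ( *%R c) (cst c x).
  move=> _; have : is_derive x (1 : R) (c \*: id) (c *: 1) by exact: is_deriveZ.
  by rewrite [c *: 1]mulr1.
rewrite /gamma_integral (ge0_integration_by_substitution_gt0 _ _ _ dF) //=.
- apply: eq_integral => x; rewrite inE/= in_itv/= andbT => x0.
  rewrite -EFinM; congr EFin; rewrite powRM ?ltW// -(gt0_mulr_powRB1 s c0).
  by ring.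
- exact: interval_is_interval.
- by move=> x y _ _; rewrite ltr_pM2l.
- by move=> x _; exact: cst_continuous.
- by move=> x; rewrite in_itv/= andbT => x0; rewrite mulr_gt0.
- move=> v v0; exists (v / c); first by rewrite in_itv/= andbT divr_gt0.
  by rewrite mulrC divfK ?gt_eqF.
- move=> v v0; apply: continuousM; first exact: continuous_powR.
  by apply: continuous_comp; [exact: continuousN|exact: continuous_expR].
- by move=> v v0; rewrite mulr_ge0 ?powR_ge0 ?expR_ge0.
Qed.

(** * The Gamma and Beta integrals *)

Lemma measurable_gamma_integrand (R : realType) (s c : R) (D : set R) :
  measurable D ->
  measurable_fun D (fun x => (x `^ (s - 1) * expR (- (c * x)))%:E).
Proof.
move=> mD; apply: measurable_funTS; apply/measurable_EFinP/measurable_funM.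
  exact: measurable_powR.
by apply: measurableT_comp => //; apply: measurableT_comp.
Qed.

Lemma measurable_beta_integrand (R : realType) (a b : R) (D : set R) :
  measurable D ->
  measurable_fun D (fun v => (v `^ (b - 1) * (1 + v) `^ (- (a + b)))%:E).
Proof.
move=> mD; apply: measurable_funTS; apply/measurable_EFinP/measurable_funM.
  exact: measurable_powR.
by apply: (measurableT_comp (measurable_powR _)); exact: measurable_funD.
Qed.

Lemma gamma_integral_ge0 (R : realType) (x : R) : (0 <= gamma_integral x)%E.
Proof.
by apply: integral_ge0 => t _; rewrite lee_fin mulr_ge0 ?powR_ge0 ?expR_ge0.
Qed.

(* Substitute x v for the variable of the second factor, swap the integrals, and
   rescale the integral in x by 1 + v. *)
Lemma gamma_integralM (R : realType) (a b : R) :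
  (gamma_integral a * gamma_integral b =
   gamma_integral (a + b) * beta_integral a b)%E.
Proof.
pose H (z : R * R) : R :=
  z.1 `^ (a - 1) * z.1 `^ b * expR (- z.1) * z.2 `^ (b - 1) * expR (- (z.1 * z.2)).
have mH : measurable_fun setT (EFin \o H).
  apply/measurable_EFinP; rewrite /H.
  repeat apply: measurable_funM.
  - by apply: (measurableT_comp (measurable_powR _)).
  - by apply: (measurableT_comp (measurable_powR _)).
  - by apply: measurableT_comp => //; apply: measurableT_comp.
  - by apply: (measurableT_comp (measurable_powR _)).
  - by apply: measurableT_comp => //; apply: measurableT_comp => //; exact: measurable_funM.
have H0 z : (0 <= (EFin \o H) z)%E.
  by rewrite lee_fin !mulr_ge0 ?powR_ge0 ?expR_ge0.
have m0 : measurable (`](0 : R), +oo[%classic) by exact: measurable_itv.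
transitivity (\int[@lebesgue_measure R]_(x in `]0%R, +oo[)
  \int[@lebesgue_measure R]_(v in `]0%R, +oo[) (EFin \o H) (x, v))%E.
  rewrite {1}/gamma_integral -ge0_integralZr ?gamma_integral_ge0//; last 2 first.
  - apply: eq_measurable_fun (measurable_gamma_integrand a 1 m0) => x _.
    by rewrite mul1r.
  - by move=> x _; rewrite lee_fin mulr_ge0 ?powR_ge0 ?expR_ge0.
  apply: eq_integral => x; rewrite inE/= in_itv/= andbT => x0.
  rewrite (gamma_integral_scale b x0) muleA -EFinM -ge0_integralZl//.
  - by apply: eq_integral => v _; rewrite -EFinM /H/=; congr EFin; ring.
  - exact: measurable_gamma_integrand.
  - by move=> v _; rewrite lee_fin mulr_ge0 ?powR_ge0 ?expR_ge0.
  - by rewrite lee_fin !mulr_ge0 ?powR_ge0 ?expR_ge0.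
rewrite fubini_tonelli_setX// [RHS]muleC [in RHS]/beta_integral.
rewrite -ge0_integralZr ?gamma_integral_ge0//; last 2 first.
- exact: measurable_beta_integrand.
- by move=> v _; rewrite lee_fin mulr_ge0 ?powR_ge0.
apply: eq_integral => v; rewrite inE/= in_itv/= andbT => v0.
have v1 : 0 < 1 + v by rewrite addr_gt0.
rewrite (gamma_integral_scale (a + b) v1) muleA -EFinM.
rewrite -mulrA powRN mulVf ?mulr1 ?gt_eqF ?powR_gt0//.
rewrite -ge0_integralZl//.
- apply: eq_integral => x; rewrite inE/= in_itv/= andbT => x0.
  have -> : x `^ (a + b - 1) = x `^ (a - 1) * x `^ b.
    by rewrite -powRD ?(gt_eqF x0) ?implybT// addrAC.
  have -> : expR (- ((1 + v) * x)) = expR (- x) * expR (- (x * v)).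
    by rewrite -expRD; congr expR; ring.
  by rewrite -EFinM /H/=; congr EFin; ring.
- exact: measurable_gamma_integrand.
- by move=> x _; rewrite lee_fin mulr_ge0 ?powR_ge0 ?expR_ge0.
- by rewrite lee_fin powR_ge0.
Qed.

Lemma gamma_integral1 (R : realType) : gamma_integral (1 : R) = 1%E.
Proof.
rewrite /gamma_integral integral_itv_obnd_cbnd; last first.
  apply: eq_measurable_fun (measurable_gamma_integrand 1 1 _) => [x _|//].
  by rewrite mul1r.
pose F (t : R) := - expR (- t).
have -> : 1%E = (0%:E - (F 0)%:E)%E.
  by rewrite /F oppr0 expR0 EFinN oppeK add0e.
have dF (x : R) : is_derive x (1 : R) F (expR (- x)).
  have -> : expR (- x) = - (expR (- x) * (- 1)) by rewrite mulrN mulr1 opprK.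
  by apply: is_deriveN; apply: is_derive1_comp.
under eq_integral do rewrite subrr powRr0 mul1r.
apply: (@ge0_continuous_FTC2y _ (fun x => expR (- x)) F 0 0) => [x _|||x _||x _].
- exact: expR_ge0.
- apply: continuous_subspaceT => x.
  by apply: continuous_comp; [exact: continuousN|exact: continuous_expR].
- by rewrite -oppr0; apply: cvgN; exact: cvgr_expR.
- exact: ex_derive.
- apply: cvg_at_right_filter.
  by apply/differentiable_continuous/derivable1_diffP; exact: ex_derive.
- by rewrite derive1E derive_val.
Qed.

Lemma cvg_powRN_pinfty (R : realType) (a : R) : 0 < a ->
  (1 + v) `^ (- a) @[v --> +oo] --> (0 : R).
Proof.
move=> a0; apply/cvgrPdist_lt => e e0; near=> v.
have v0 : 0 < 1 + v by rewrite addr_gt0//; near: v; exact: nbhs_pinfty_gt.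
rewrite sub0r normrN ger0_norm ?powR_ge0// powRN -[ltRHS]invrK ltf_pV2 ?posrE ?invr_gt0 ?powR_gt0//.
(* Writing the bound as an a-th power reduces the comparison to the bases. *)
have -> : e^-1 = (e^-1 `^ a^-1) `^ a.
  by rewrite -powRrM mulVf ?gt_eqF// powRr1// invr_ge0 ltW.
rewrite gt0_ltr_powR ?nnegrE ?powR_ge0 ?ltW//.
rewrite (@lt_trans _ _ v) ?ltrDr//; near: v; apply: nbhs_pinfty_gt; exact: num_real.
Unshelve. all: by end_near. Qed.

(** For b = 1 the integrand is (1 + v)^(- (a + 1)), with antiderivative - (1 + v)^(- a) / a, which
    vanishes at +oo. *)
Lemma beta_integralr1 (R : realType) (a : R) : 0 < a ->
  beta_integral a 1 = (a^-1)%:E.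
Proof.
move=> a0; rewrite /beta_integral integral_itv_obnd_cbnd; last first.
  exact: measurable_beta_integrand.
under eq_integral do rewrite subrr powRr0 mul1r.
pose F (v : R) := - a^-1 * (1 + v) `^ (- a).
have -> : (a^-1)%:E = (0%:E - (F 0)%:E)%E.
  by rewrite /F addr0 powR1 mulr1 EFinN oppeK add0e.
have d1 (x : R) : is_derive x (1 : R) (fun v => 1 + v) (0 + 1) by exact: is_deriveD.
have dp (p x : R) : -1 < x ->
    is_derive x (1 : R) (fun v => (1 + v) `^ p) (p * (1 + x) `^ (p - 1)).
  move=> x1; have {}x1 : 0 < 1 + x by lra.
  by have := is_derive1_comp (is_derive1_powR p x1) (d1 x); rewrite add0r mulr1.
have dF (x : R) : -1 < x -> is_derive x (1 : R) F ((1 + x) `^ (- (a + 1))).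
  move=> x1; have := dp (- a) x x1.
  move=> /(is_deriveZ (- a^-1)).
  by rewrite [X in is_derive _ _ _ X]mulrA mulrNN mulVf ?gt_eqF// mul1r opprD.
apply: (@ge0_continuous_FTC2y _ (fun v => (1 + v) `^ (- (a + 1))) F 0 0) => [x _|||x x0||x].
- exact: powR_ge0.
- apply: continuous_in_subspaceT => x; rewrite inE/= in_itv/= andbT => x0.
  apply/differentiable_continuous/derivable1_diffP.
  by have := dp (- (a + 1)) x ltac:(by lra) => ?; exact: ex_derive.
- rewrite -(mulr0 (- a^-1)); apply: cvgM; first exact: cvg_cst.
  exact: cvg_powRN_pinfty.
- by have := dF x ltac:(by lra) => ?; exact: ex_derive.
- apply: cvg_at_right_filter; apply/differentiable_continuous/derivable1_diffP.
  by have := dF 0 ltac:(by lra) => ?; exact: ex_derive.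
- rewrite in_itv/= andbT => x0; rewrite derive1E.
  by have := dF x ltac:(by lra) => ?; rewrite derive_val.
Qed.

Lemma gamma_integralD1 (R : realType) (a : R) : 0 < a ->
  gamma_integral (a + 1) = (a%:E * gamma_integral a)%E.
Proof.
move=> a0; have := gamma_integralM a 1.
rewrite gamma_integral1 mule1 beta_integralr1// => ->.
by rewrite muleCA -EFinM divff ?gt_eqF// mule1.
Qed.

Lemma gamma_integral_nat (R : realType) (n : nat) :
  gamma_integral (n.+1%:R : R) = (n`!%:R)%:E.
Proof.
elim: n => [|n IHn]; first by rewrite gamma_integral1.
by rewrite -natr1 gamma_integralD1// IHn -EFinM -natrM factS.
Qed.

(* t^(y - 1) <= t^(x - 1) for t <= 1, and t^(y - 1) <= t^x for t >= 1. Comparison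
   with factorials then yields finiteness and positivity without estimates near 0
   or +oo. *)
Lemma gamma_integral_le (R : realType) (x y : R) : x <= y <= x + 1 ->
  (gamma_integral y <= gamma_integral x + gamma_integral (x + 1))%E.
Proof.
move=> /andP[xy yx].
have m (s : R) : measurable_fun `](0:R), +oo[ (fun t => (t `^ (s - 1) * expR (- t))%:E).
  apply: eq_measurable_fun (measurable_gamma_integrand s 1 _) => [t _|//].
  by rewrite mul1r.
have f0 (s t : R) : (0 <= (t `^ (s - 1) * expR (- t))%:E)%E.
  by rewrite lee_fin mulr_ge0 ?powR_ge0 ?expR_ge0.
rewrite /gamma_integral -ge0_integralD//; [|exact: m|exact: m].
apply: (@ge0_le_integral _ (measurableTypeR R) R lebesgue_measure) => //.
- exact: m.
- by apply: emeasurable_funD; exact: m.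
move=> t; rewrite /= in_itv/= andbT => t0.
rewrite -EFinD lee_fin -mulrDl ler_pM2r ?expR_gt0//.
have [t1|t1] := leP t 1.
  by rewrite ler_wpDr ?powR_ge0// ger_powR ?t0// lerB.
by rewrite ler_wpDl ?powR_ge0// ler_powR ?lerB// ltW.
Qed.

Lemma gamma_integral_lty (R : realType) (x : R) : 0 < x ->
  (gamma_integral x < +oo)%E.
Proof.
move=> x0; have := Num.Theory.truncn_itv (ltW x0).
set n := Num.truncn x => /andP[nx xn].
(* Comparing at x + 1 rather than x keeps the lower point n + 1 positive even when x < 1; the
   functional equation then brings finiteness back to x. *)
have : (gamma_integral (x + 1) < +oo)%E.
  apply: le_lt_trans (@gamma_integral_le _ n.+1%:R (x + 1) _) _.
    by rewrite -(natr1 n) !lerD2r nx/= natr1 ltW.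
  by rewrite natr1 !gamma_integral_nat -EFinD ltry.
rewrite gamma_integralD1//; case: (gamma_integral x) (gamma_integral_ge0 x) => //=.
  by move=> r _ _; rewrite ltry.
by rewrite mulry gtr0_sg// mul1e.
Qed.

Lemma gamma_integral_gt0 (R : realType) (x : R) : 0 < x ->
  (0 < gamma_integral x)%E.
Proof.
move=> x0; rewrite lt_neqAle gamma_integral_ge0 andbT; apply/eqP => Gx.
have := Num.Theory.truncn_itv (ltW x0).
set n := Num.truncn x => /andP[nx xn].
(* The integer n + 1 lies between x and x + 1. If the integral vanished at x it would vanish at x +
   1 too, forcing n! <= 0. *)
have := @gamma_integral_le _ x n.+1%:R.
rewrite ltW//= -(natr1 n) lerD2r nx => /(_ isT).
rewrite natr1 gamma_integralD1// -Gx mule0 adde0 gamma_integral_nat lee_fin.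
by rewrite leNgt ltr0n fact_gt0.
Qed.

Lemma gt0_GammaE (R : realType) (x : R) : 0 < x ->
  (Gamma x)%:E = gamma_integral x.
Proof.
move=> x0; rewrite /Gamma x0 addr0 big_ord0 divr1.
by rewrite /euler_gamma /Rintegral fineK// ge0_fin_numE ?gamma_integral_ge0// gamma_integral_lty.
Qed.

Lemma Gamma_gt0 (R : realType) (x : R) : 0 < x -> 0 < Gamma x.
Proof. by move=> x0; rewrite -lte_fin gt0_GammaE// gamma_integral_gt0. Qed.

Lemma GammaD1 (R : realType) (x : R) : 0 < x -> Gamma (x + 1) = x * Gamma x.
Proof.
move=> x0; have := gamma_integralD1 x0.
by rewrite -!gt0_GammaE ?addr_gt0// -EFinM => -[].
Qed.

(** Taking the Gamma quotient as definition makes the recurrences in a and b consequences of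
    [GammaD1] alone. *)
Definition beta (R : realType) (a b : R) : R := Gamma a * Gamma b / Gamma (a + b).

Lemma beta_integralE (R : realType) (a b : R) : 0 < a -> 0 < b ->
  beta_integral a b = (beta a b)%:E.
Proof.
move=> a0 b0; have ab0 : 0 < a + b by rewrite addr_gt0.
have := gamma_integralM a b; rewrite -!gt0_GammaE// => h.
rewrite /beta mulrC EFinM EFinM h muleA -EFinM mulVf ?mul1e//.
by rewrite gt_eqF// Gamma_gt0.
Qed.

(** Substitute v = 1/y - 1, so that 1 + v = 1/y and v = (1 - y)/y. It serves both weights, with y =
    (1 - x)/2 and with y = (1 - t)^rho. *)
Lemma beta_integral_substitution (R : realType) (A : set R) (y f : R -> R) (a b : R) :
  open A -> is_interval A ->
  {in A &, {homo y : s t /~ s < t}} ->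
  (forall x, A x -> is_derive x 1 y (- f x)) ->
  (forall x, A x -> {for x, continuous f}) ->
  (forall x, A x -> 0 < y x < 1) ->
  (forall u : R, 0 < u < 1 -> exists2 x, A x & y x = u) ->
  (\int[@lebesgue_measure R]_(x in A)
     ((1 - y x) `^ (b - 1) * y x `^ (a - 1) * f x)%:E)%E = beta_integral a b.
Proof.
move=> oA iA dy Dy cf y01 sy.
have y0 x : A x -> 0 < y x by move=> /y01/andP[].
have y1 x : A x -> y x < 1 by move=> /y01/andP[].
have cy x : A x -> {for x, continuous y}.
  by move=> /Dy ?; apply/differentiable_continuous/derivable1_diffP.
have DF x : A x -> is_derive x (1 : R) (fun t => (y t)^-1 - 1) (f x * (y x) ^- 2).
  move=> Ax; have ? := Dy x Ax.
  have := is_deriveB (is_deriveV (lt0r_neq0 (y0 _ Ax)) (Dy x Ax)) (is_derive_cst (1 : R) x 1).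
  by rewrite subr0 scaleNr scalerN opprK [_ *: _]mulrC.
rewrite /beta_integral (ge0_integration_by_substitution_gt0 oA iA _ DF).
- apply: eq_integral => x; rewrite inE => Ax; congr EFin.
  have yx := y0 _ Ax.
  have -> : 1 + ((y x)^-1 - 1) = (y x)^-1 by rewrite addrC subrK.
  have -> : (y x)^-1 - 1 = (1 - y x) * (y x)^-1 by rewrite mulrBl mul1r divff ?gt_eqF.
  rewrite powRM ?invr_ge0 ?subr_ge0 ?ltW ?y1//.
  have yV p : (y x)^-1 `^ p = y x `^ (- p).
    by rewrite -powR_inv1 ?ltW// -powRrM mulN1r.
  (* The three factors come from v^(b - 1), from (1 + v)^(- (a + b)) and from the derivative of
     1/y. *)
  have -> : y x `^ (a - 1) = y x `^ (- (b - 1)) * y x `^ (a + b) * y x ^- 2.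
    rewrite -(powR_invn 2 (ltW yx)) -!powRD ?(gt_eqF yx) ?implybT//.
    by congr (_ `^ _); ring.
  by rewrite !yV opprK; ring.
- move=> s t As At st; rewrite ltrD2r ltf_pV2 ?posrE; [exact: dy| |].
    by apply: y0; rewrite -in_setE.
  by apply: y0; rewrite -in_setE.
- move=> x Ax; have yx := y0 _ Ax; apply: continuousM; first exact: cf.
  apply: cvgV; first by rewrite expf_neq0 ?gt_eqF.
  apply: (@continuous_comp _ _ _ y (fun u => u ^+ 2)); first exact: cy.
  exact: exprn_continuous.
- by move=> x Ax; rewrite subr_gt0 invf_gt1 ?y0 ?y1.
- move=> v v0; have v1 : 0 < v + 1 by rewrite addr_gt0.
  have [x Ax yx] : exists2 x, A x & y x = (v + 1)^-1.
    by apply: sy; rewrite invr_gt0 v1/= invf_lt1// ltrDr.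
  by exists x => //; rewrite yx invrK addrK.
- move=> v v0; apply: continuousM; first exact: continuous_powR.
  apply: (@continuous_comp _ _ _ (fun w : R => 1 + w) (fun w : R => w `^ (- (a + b))) v).
    by apply: continuousD; [exact: cst_continuous|].
  by apply: continuous_powR; rewrite addr_gt0.
- by move=> v v0; rewrite mulr_ge0 ?powR_ge0.
Qed.

(** * Moments of the weights *)

(** With y = (1 - x)/2 one has 1 - x = 2 y, 1 + x = 2 (1 - y) and dx = - 2 dy, whence the power of
    2. *)
Lemma jacobi_weight_moment (R : realType) (mu ups : R) (n : nat) :
  -1 < mu -> -1 < ups ->
  (\int[@lebesgue_measure R]_(x in `[(-1)%R, 1%R])
     (jacobi_weight mu ups x * ((1 - x) / 2) ^+ n)%:E =
   (2 `^ (mu + ups + 1) * beta (mu + 1 + n%:R) (ups + 1))%:E)%E.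
Proof.
move=> hmu hups; have n0 : 0 <= n%:R :> R by [].
have mw : measurable_fun setT (fun x : R => (jacobi_weight mu ups x * ((1 - x) / 2) ^+ n)%:E).
  apply/measurable_EFinP/measurable_funM; first apply: measurable_funM.
  - by apply: (measurableT_comp (measurable_powR _)); exact: measurable_funB.
  - by apply: (measurableT_comp (measurable_powR _)); exact: measurable_funD.
  - by apply: measurable_funX; apply: measurable_funM => //; exact: measurable_funB.
(* Dropping the endpoints, a null set, avoids powers with base 0. *)
rewrite integral_itv_bndoo; last exact: measurable_funTS.
rewrite EFinM -beta_integralE; [|lra..].
have Dy (x : R) : `]-1, 1[%classic x ->
    is_derive x (1 : R) (fun x : R => (1 - x) / 2) (- cst 2^-1 x).
  move=> _.
  have := is_deriveZ (2^-1) (is_deriveB (is_derive_cst (1 : R) x 1) (is_derive_id x (1 : R))).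
  rewrite sub0r scalerN [_ *: _]mulr1; congr (is_derive _ _ _ _).
  by apply/funext => z; rewrite mulrC.
rewrite -(beta_integral_substitution _ _ _ _ _ Dy).
- rewrite -ge0_integralZl//.
  + apply: eq_integral => x; rewrite inE/= in_itv/= => /andP[x1 x2].
    rewrite /=; set y := (1 - x) / 2; have y0 : 0 < y by rewrite /y; lra.
    have y1 : 0 < 1 - y by rewrite /y; lra.
    rewrite -EFinM; congr EFin.
    have x1E : 1 - x = 2 * y by rewrite /y; field.
    have x2E : 1 + x = 2 * (1 - y) by rewrite /y; field.
    rewrite /jacobi_weight x1E x2E; clearbody y.
    rewrite !powRM ?ltW//.
    rewrite -(powR_mulrn n (ltW y0)) addrK.
    rewrite (_ : mu + 1 + n%:R - 1 = mu + n%:R); last by ring.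
    rewrite (@powRD _ y mu n%:R) ?(gt_eqF y0) ?implybT//.
    rewrite !powRD ?pnatr_eq0 ?implybT// powRr1//=.
    by field.
  + apply: measurable_funTS; apply/measurable_EFinP/measurable_funM => //.
    apply: measurable_funM; apply: (measurableT_comp (measurable_powR _)).
      by apply: measurable_funB => //; apply: measurable_funM => //; exact: measurable_funB.
    by apply: measurable_funM => //; exact: measurable_funB.
  + by move=> x _; rewrite lee_fin /= divr_ge0 ?mulr_ge0 ?powR_ge0.
- exact: itv_open.
- exact: interval_is_interval.
- by move=> s t _ _ st; rewrite ltr_pM2r// ltrD2l ltrN2.
- by move=> x _; exact: cst_continuous.
- by move=> x; rewrite /= in_itv/= => /andP[x1 x2]; apply/andP; split; lra.
- move=> u /andP[u0 u1]; exists (1 - 2 * u); last by field.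
  by rewrite /= in_itv/=; apply/andP; split; lra.
Qed.

(** With y = (1 - t)^rho the measure [varkappa] dt becomes - y^mu (1 - y)^ups dy, so rho disappears
    from the moments. *)
Lemma varkappa_moment (R : realType) (mu ups rho : R) (n : nat) :
  -1 < mu -> -1 < ups -> 0 < rho ->
  (\int[@lebesgue_measure R]_(t in `[0%R, 1%R])
     (varkappa mu ups rho t * ((1 - t) `^ rho) ^+ n)%:E =
   (beta (mu + 1 + n%:R) (ups + 1))%:E)%E.
Proof.
move=> hmu hups hrho; have n0 : 0 <= n%:R :> R by [].
have p1 (p : R) : 1 `^ p = 1 :> R by rewrite powR1.
have mp (p : R) : measurable_fun setT (fun t : R => (1 - t) `^ p).
  by apply: (measurableT_comp (measurable_powR _)); exact: measurable_funB.
have mw : measurable_fun setT (fun t : R => (varkappa mu ups rho t * ((1 - t) `^ rho) ^+ n)%:E).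
  apply/measurable_EFinP/measurable_funM; last exact/measurable_funX.
  apply: measurable_funM; first exact: measurable_funM.
  by apply: (measurableT_comp (measurable_powR _)); exact: measurable_funB.
rewrite integral_itv_bndoo; last exact: measurable_funTS.
rewrite -beta_integralE; [|lra..].
have Dy (t : R) : `]0, 1[%classic t ->
    is_derive t (1 : R) (fun t : R => (1 - t) `^ rho) (- (rho * (1 - t) `^ (rho - 1))).
  rewrite /= in_itv/= => /andP[t0 t1].
  have u0 : 0 < 1 - t by rewrite subr_gt0.
  have := @is_derive1_comp _ _ (fun s => 1 - s) _ _ _ (is_derive1_powR rho u0)
    (is_deriveB (is_derive_cst (1 : R) t 1) (is_derive_id t (1 : R))).
  by rewrite sub0r mulrN1.
rewrite -(beta_integral_substitution _ _ _ _ _ Dy).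
- apply: eq_integral => t; rewrite inE/= in_itv/= => /andP[t0 t1].
  have u0 : 0 < 1 - t by rewrite subr_gt0.
  congr EFin; rewrite /varkappa addrK -powR_mulrn ?powR_ge0// -!powRrM.
  have -> : rho * (mu + 1) - 1 = rho * mu + (rho - 1) by ring.
  have -> : rho * (mu + 1 + n%:R - 1) = rho * mu + rho * n%:R by ring.
  by rewrite !powRD ?(gt_eqF u0) ?implybT//; ring.
- exact: itv_open.
- exact: interval_is_interval.
- move=> s t; rewrite !inE/= !in_itv/= => /andP[s0 s1] /andP[t0 t1] st.
  by rewrite gt0_ltr_powR ?nnegrE; lra.
- move=> t; rewrite /= in_itv/= => /andP[t0 t1].
  apply: continuousM; first exact: cst_continuous.
  apply: (@continuous_comp _ _ _ (fun t : R => 1 - t) (fun u : R => u `^ (rho - 1)) t).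
    by apply: continuousB; [exact: cst_continuous|].
  by apply: continuous_powR; rewrite subr_gt0.
- move=> t; rewrite /= in_itv/= => /andP[t0 t1].
  have u0 : 0 < 1 - t by rewrite subr_gt0.
  rewrite powR_gt0//= -[ltRHS](p1 rho) gt0_ltr_powR ?nnegrE//; lra.
- move=> u /andP[u0 u1]; exists (1 - u `^ rho^-1).
    rewrite /= in_itv/= subr_gt0 gtrBl powR_gt0// andbT.
    by rewrite -[ltRHS](p1 rho^-1) gt0_ltr_powR ?nnegrE ?invr_gt0 ?ltW.
  by rewrite subKr -powRrM mulVf ?gt_eqF// powRr1// ltW.
Qed.

(** Each w y^n is nonnegative with finite integral, hence integrable, and the integral can be split
    along the coefficients of p. *)
Lemma integral_weighted_poly (R : realType) (D : set R) (w y : R -> R)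
    (m : nat -> R) (p : {poly R}) :
  measurable D ->
  (forall n, measurable_fun D (fun x => w x * y x ^+ n)) ->
  (forall x, D x -> 0 <= w x) -> (forall x, D x -> 0 <= y x) ->
  (forall n, \int[@lebesgue_measure R]_(x in D) (w x * y x ^+ n)%:E = (m n)%:E)%E ->
  (\int[@lebesgue_measure R]_(x in D) (w x * p.[y x])%:E =
   (\sum_(i < size p) p`_i * m i)%:E)%E.
Proof.
move=> mD mwy w0 y0 wym.
have int n : lebesgue_measure.-integrable D (fun x => (w x * y x ^+ n)%:E).
  apply/integrableP; split; first by apply/measurable_EFinP; exact: mwy.
  rewrite [ltLHS](_ : _ = (m n)%:E) ?ltry// -wym; apply: eq_integral => x.
  by rewrite inE => Dx; rewrite /= ger0_norm// mulr_ge0 ?exprn_ge0 ?w0 ?y0.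
transitivity (\int[@lebesgue_measure R]_(x in D)
    \sum_(i < size p) (p`_i)%:E * (w x * y x ^+ i)%:E)%E.
  apply: eq_integral => x _; rewrite horner_coef mulr_sumr -sumEFin.
  by apply: eq_bigr => i _; rewrite -EFinM mulrCA.
rewrite integral_sum//; last by move=> i; exact: integrableZl.
rewrite -sumEFin; apply: eq_bigr => i _.
by rewrite integralZl// wym -EFinM.
Qed.

(* The integral of p against y^(a - 1) (1 - y)^(b - 1) over [0, 1], read off the
   moments. *)
Definition beta_form (R : realType) (a b : R) (p : {poly R}) : R :=
  \sum_(i < size p) p`_i * beta (a + i%:R) b.

Lemma integral_jacobi_weight (R : realType) (mu ups : R) (p : {poly R}) :
  -1 < mu -> -1 < ups ->
  (\int[@lebesgue_measure R]_(x in `[(-1)%R, 1%R])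
     (jacobi_weight mu ups x * p.[(1 - x) / 2])%:E =
   (2 `^ (mu + ups + 1) * beta_form (mu + 1) (ups + 1) p)%:E)%E.
Proof.
move=> hmu hups.
rewrite (@integral_weighted_poly _ _ _ (fun x => (1 - x) / 2)
  (fun n => 2 `^ (mu + ups + 1) * beta (mu + 1 + n%:R) (ups + 1))).
- rewrite /beta_form mulr_sumr; congr EFin.
  by apply: eq_bigr => i _; rewrite mulrCA.
- exact: measurable_itv.
- move=> n; apply: measurable_funTS; apply: measurable_funM; first apply: measurable_funM.
  - by apply: (measurableT_comp (measurable_powR _)); exact: measurable_funB.
  - by apply: (measurableT_comp (measurable_powR _)); exact: measurable_funD.
  - by apply: measurable_funX; apply: measurable_funM => //; exact: measurable_funB.
- by move=> x _; rewrite mulr_ge0 ?powR_ge0.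
- by move=> x; rewrite /= in_itv/= => /andP[x1 x2]; rewrite divr_ge0// subr_ge0.
- by move=> n; exact: jacobi_weight_moment.
Qed.

Lemma integral_varkappa (R : realType) (mu ups rho : R) (p : {poly R}) :
  -1 < mu -> -1 < ups -> 0 < rho ->
  (\int[@lebesgue_measure R]_(t in `[0%R, 1%R])
     (varkappa mu ups rho t * p.[(1 - t) `^ rho])%:E =
   (beta_form (mu + 1) (ups + 1) p)%:E)%E.
Proof.
move=> hmu hups hrho.
have mp (q : R) : measurable_fun setT (fun t : R => (1 - t) `^ q).
  by apply: (measurableT_comp (measurable_powR _)); exact: measurable_funB.
rewrite (@integral_weighted_poly _ _ _ (fun t => (1 - t) `^ rho)
  (fun n => beta (mu + 1 + n%:R) (ups + 1)))//.
- move=> n; apply: measurable_funTS; apply: measurable_funM; last exact/measurable_funX.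
  apply: measurable_funM; first exact: measurable_funM.
  by apply: (measurableT_comp (measurable_powR _)); exact: measurable_funB.
- by move=> t _; rewrite !mulr_ge0 ?powR_ge0 ?ltW.
- by move=> t _; rewrite powR_ge0.
- by move=> n; exact: varkappa_moment.
Qed.

(** * Jacobi polynomials on the unit interval *)

Lemma beta_gt0 (R : realType) (a b : R) : 0 < a -> 0 < b -> 0 < beta a b.
Proof.
move=> a0 b0; exact: divr_gt0 (mulr_gt0 (Gamma_gt0 a0) (Gamma_gt0 b0))
  (Gamma_gt0 (addr_gt0 a0 b0)).
Qed.

Lemma betaD1l (R : realType) (a b : R) : 0 < a -> 0 < b ->
  beta (a + 1) b = a / (a + b) * beta a b.
Proof.
move=> a0 b0; have ab0 : 0 < a + b by rewrite addr_gt0.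
have := Gamma_gt0 ab0; rewrite /beta addrAC !GammaD1// => G0.
by field; rewrite (gt_eqF G0) (gt_eqF ab0).
Qed.

Lemma betaD1r (R : realType) (a b : R) : 0 < a -> 0 < b ->
  beta a (b + 1) = b / (a + b) * beta a b.
Proof.
move=> a0 b0; have ab0 : 0 < a + b by rewrite addr_gt0.
have := Gamma_gt0 ab0; rewrite /beta addrA !GammaD1// => G0.
by field; rewrite (gt_eqF G0) (gt_eqF ab0).
Qed.

Lemma beta_formE (R : realType) (a b : R) (n : nat) (p : {poly R}) :
  (size p <= n)%N -> beta_form a b p = \sum_(i < n) p`_i * beta (a + i%:R) b.
Proof.
move=> pn; rewrite /beta_form (big_ord_widen n (fun i => p`_i * beta (a + i%:R) b))//.
rewrite big_mkcond/=; apply: eq_bigr => i _; case: ltnP => // /(nth_default 0) ->.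
by rewrite mul0r.
Qed.

Lemma beta_formD (R : realType) (a b : R) (p q : {poly R}) :
  beta_form a b (p + q) = beta_form a b p + beta_form a b q.
Proof.
pose n := maxn (size (p + q)) (maxn (size p) (size q)).
rewrite !(@beta_formE _ a b n) ?leq_max ?leqnn ?orbT//.
by rewrite -big_split/=; apply: eq_bigr => i _; rewrite coefD mulrDl.
Qed.

Lemma beta_formZ (R : realType) (a b c : R) (p : {poly R}) :
  beta_form a b (c *: p) = c * beta_form a b p.
Proof.
rewrite (@beta_formE _ a b (size p)) ?size_scale_leq// mulr_sumr.
by apply: eq_bigr => i _; rewrite coefZ -mulrA.
Qed.

Lemma beta_formN (R : realType) (a b : R) (p : {poly R}) :
  beta_form a b (- p) = - beta_form a b p.
Proof. by rewrite -scaleN1r beta_formZ mulN1r. Qed.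

Lemma beta_formXn (R : realType) (a b : R) (n : nat) :
  beta_form a b 'X^n = beta (a + n%:R) b.
Proof.
rewrite /beta_form size_polyXn big_ord_recr/= big1 ?add0r ?coefXn ?eqxx ?mul1r//.
by move=> i _; rewrite coefXn ltn_eqF ?mul0r.
Qed.

(** Reduces identities between integrals to monomials, where they become relations between values of
    [beta]. *)
Lemma eq_scalar_poly (R : realType) (f g : {poly R} -> R) :
  (forall p q, f (p + q) = f p + f q) -> (forall c p, f (c *: p) = c * f p) ->
  (forall p q, g (p + q) = g p + g q) -> (forall c p, g (c *: p) = c * g p) ->
  (forall n, f 'X^n = g 'X^n) -> f =1 g.
Proof.
move=> fD fZ gD gZ fg p; rewrite -(coefK p) poly_def.
apply: (big_ind (fun q => f q = g q)).
- by rewrite -(scale0r 0) fZ gZ !mul0r.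
- by move=> q s fgq fgs; rewrite fD gD fgq fgs.
- by move=> i _; rewrite fZ gZ fg.
Qed.

(** The weights for (a + 1, b + 1) and (a, b) differ by the factor y (1 - y). *)
Lemma beta_form_weight (R : realType) (a b : R) (p : {poly R}) :
  0 < a -> 0 < b ->
  beta_form (a + 1) (b + 1) p = beta_form a b ('X * (1 - 'X) * p).
Proof.
move=> a0 b0; move: p; apply: eq_scalar_poly => [p q|c p|p q|c p|n].
- exact: beta_formD.
- exact: beta_formZ.
- by rewrite mulrDr beta_formD.
- by rewrite -scalerAr beta_formZ.
have n0 : 0 <= n%:R :> R by [].
have -> : ('X * (1 - 'X) * 'X^n : {poly R}) = 'X^(n.+1) - 'X^(n.+2) by rewrite !exprS; ring.
rewrite beta_formD beta_formN !beta_formXn -!natr1 !addrA.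
rewrite (addrAC a 1) betaD1r; [|lra..].
rewrite !betaD1l; [|lra..].
by field; apply/andP; split; apply: lt0r_neq0; lra.
Qed.

(** This is integration by parts: the derivative of y^a (1 - y)^b is (a - (a + b) y) y^(a - 1) (1 -
    y)^(b - 1), and the boundary terms vanish for a, b > 0. *)
Lemma beta_form_deriv (R : realType) (a b : R) (p : {poly R}) :
  0 < a -> 0 < b ->
  beta_form (a + 1) (b + 1) p^`() = beta_form a b (((a + b) *: 'X - a%:P) * p).
Proof.
move=> a0 b0; move: p; apply: eq_scalar_poly => [p q|c p|p q|c p|n].
- by rewrite derivD beta_formD.
- by rewrite derivZ beta_formZ.
- by rewrite mulrDr beta_formD.
- by rewrite -scalerAr beta_formZ.
have n0 : 0 <= n%:R :> R by [].
rewrite mulrBl -scalerAl -exprS mul_polyC beta_formD beta_formN !beta_formZ.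
rewrite derivXn !beta_formXn -!natr1 addrA betaD1l; [|lra..].
(* The derivative of a monomial has a truncated predecessor as exponent, so the constant one is
   treated apart. *)
case: n n0 => [|n] n0.
  rewrite mulr0n -(scale0r 0) beta_formZ mul0r addr0.
  by field; apply: lt0r_neq0; lra.
rewrite -scaler_nat beta_formZ beta_formXn/= (addrAC a 1) betaD1r; [|lra..].
rewrite -addrA natr1; by field; apply: lt0r_neq0; lra.
Qed.

(* Rodrigues: y^(a - 1) (1 - y)^(b - 1) (jacobi_raise a b q) is the derivative of
   y^a (1 - y)^b q. *)
Definition jacobi_raise (R : realType) (a b : R) (q : {poly R}) : {poly R} :=
  'X * (1 - 'X) * q^`() + (a%:P - (a + b) *: 'X) * q.

(** In the (a + 1, b + 1) form the two terms of [jacobi_raise] contribute p q' and - (p q)', and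
    Leibniz leaves - p' q. *)
Lemma beta_form_raise (R : realType) (a b : R) (p q : {poly R}) :
  0 < a -> 0 < b ->
  beta_form a b (p * jacobi_raise a b q) = - beta_form (a + 1) (b + 1) (p^`() * q).
Proof.
move=> a0 b0; have -> : p * jacobi_raise a b q =
    'X * (1 - 'X) * (p * q^`()) - ((a + b) *: 'X - a%:P) * (p * q).
  by rewrite /jacobi_raise; ring.
rewrite beta_formD beta_formN -beta_form_weight// -beta_form_deriv//.
by rewrite derivM beta_formD; ring.
Qed.

(* P_r^{a-1,b-1}(1 - 2 y) as a polynomial in y. *)
Fixpoint shifted_jacobi (R : realType) (r : nat) (a b : R) : {poly R} :=
  if r is n.+1 then
    n.+1%:R^-1 *: jacobi_raise a b (shifted_jacobi n (a + 1) (b + 1))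
  else 1.

(** Differentiating y (1 - y) adds 1 - 2 y to the coefficient of q', which raises a and b by one;
    differentiating the linear factor leaves - (a + b) q. *)
Lemma deriv_jacobi_raise (R : realType) (a b : R) (q : {poly R}) :
  (jacobi_raise a b q)^`() = jacobi_raise (a + 1) (b + 1) q^`() - (a + b) *: q.
Proof.
rewrite /jacobi_raise !poly.derivE -!mul_polyC !polyCD; ring.
Qed.

Lemma deriv_shifted_jacobi (R : realType) (r : nat) (a b : R) :
  (shifted_jacobi r.+1 a b)^`() =
  - ((r%:R + a + b) *: shifted_jacobi r (a + 1) (b + 1)).
Proof.
elim: r a b => [|r IHr] a b.
  by rewrite /= /jacobi_raise !poly.derivE; rewrite invr1 scale1r -!mul_polyC !polyCD; ring.
have -> : shifted_jacobi r.+2 a b =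
  r.+2%:R^-1 *: jacobi_raise a b (shifted_jacobi r.+1 (a + 1) (b + 1)) by [].
rewrite derivZ deriv_jacobi_raise IHr.
set q := shifted_jacobi r.+1 _ _.
(* The raised derivative is again a multiple of q by the Rodrigues recursion. The coefficients then
   combine through (r + a + b + 2)(r + 1) + (a + b) = (r + 2)(r + 1 + a + b). *)
have -> : jacobi_raise (a + 1) (b + 1) (- ((r%:R + (a + 1) + (b + 1)) *:
     shifted_jacobi r (a + 1 + 1) (b + 1 + 1))) =
     - ((r%:R + (a + 1) + (b + 1)) * r.+1%:R) *: q.
  rewrite /q /= scalerA mulNr -mulrA divff ?pnatr_eq0// mulr1.
  by rewrite /jacobi_raise derivN derivZ -!mul_polyC !polyCN; ring.
rewrite -scalerBl scalerA -[RHS]scaleNr; congr (_ *: _).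
by rewrite -!natr1; field; rewrite !natr1 pnatr_eq0.
Qed.

Lemma shifted_jacobiS (R : realType) (r : nat) (a b : R) :
  shifted_jacobi r.+1 a b =
  r.+1%:R^-1 *: jacobi_raise a b (shifted_jacobi r (a + 1) (b + 1)).
Proof. by []. Qed.

(** The degree is read off the derivative, a multiple of the previous polynomial by a coefficient r
    + a + b that is positive. *)
Lemma size_shifted_jacobi (R : realType) (r : nat) (a b : R) :
  0 < a -> 0 < b -> size (shifted_jacobi r a b) = r.+1.
Proof.
elim: r a b => [|r IHr] a b a0 b0; first by rewrite size_poly1.
have r0 : 0 <= r%:R :> R by [].
have := polyorder.size_deriv (shifted_jacobi r.+1 a b).
rewrite deriv_shifted_jacobi size_polyN size_scale; last by apply: lt0r_neq0; lra.
rewrite IHr; [|lra..].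
by case: (size _) => //= n ->.
Qed.

(** At y = 0, that is x = 1, [jacobi_raise] is multiplication by a, and the recursion yields the
    standard normalization. *)
Lemma horner0_shifted_jacobi (R : realType) (r : nat) (a b : R) :
  0 < a -> (shifted_jacobi r a b).[0] = Gamma (r%:R + a) / (r`!%:R * Gamma a).
Proof.
elim: r a b => [|r IHr] a b a0.
  by rewrite hornerC fact0 mul1r add0r divff// gt_eqF// Gamma_gt0.
rewrite shifted_jacobiS /jacobi_raise hornerZ hornerD !hornerM hornerX !mul0r add0r.
rewrite hornerD hornerC hornerN hornerZ hornerX mulr0 subr0 IHr; last lra.
have r0 : 0 <= r%:R :> R by [].
rewrite GammaD1// (_ : r.+1%:R + a = r%:R + (a + 1)); last by rewrite -natr1; ring.
rewrite factS natrM.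
have G0 := Gamma_gt0 a0; have f0 : 0 < r`!%:R :> R by rewrite ltr0n fact_gt0.
by field; rewrite (gt_eqF G0) (gt_eqF f0) (gt_eqF a0) gt_eqF//; lra.
Qed.

(** Each use of adjointness differentiates p once and lowers r by one; p vanishes before r runs
    out. *)
Lemma beta_form_shifted_jacobi0 (R : realType) (r : nat) (a b : R) (p : {poly R}) :
  0 < a -> 0 < b -> (size p <= r)%N -> beta_form a b (p * shifted_jacobi r a b) = 0.
Proof.
elim: r a b p => [|r IHr] a b p a0 b0.
  by rewrite leqn0 size_poly_eq0 => /eqP ->; rewrite mul0r /beta_form size_poly0 big_ord0.
move=> sp; rewrite shifted_jacobiS -scalerAr beta_formZ beta_form_raise//.
by rewrite IHr ?oppr0 ?mulr0 ?addr_gt0// polyorder.size_deriv; case: (size p) sp.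
Qed.

Definition shifted_jacobi_norm (R : realType) (r : nat) (a b : R) : R :=
  beta_form a b (shifted_jacobi r a b * shifted_jacobi r a b).

Lemma shifted_jacobi_norm0 (R : realType) (a b : R) :
  shifted_jacobi_norm 0 a b = beta a b.
Proof.
by have := beta_formXn a b 0; rewrite expr0 addr0 /shifted_jacobi_norm/= mulr1.
Qed.

(** One factor is written by Rodrigues and the operator is moved to the other, whose derivative is
    known; the two signs cancel. *)
Lemma shifted_jacobi_normS (R : realType) (r : nat) (a b : R) :
  0 < a -> 0 < b ->
  shifted_jacobi_norm r.+1 a b =
  (r%:R + a + b) / r.+1%:R * shifted_jacobi_norm r (a + 1) (b + 1).
Proof.
move=> a0 b0; rewrite /shifted_jacobi_norm {2}shifted_jacobiS -scalerAr beta_formZ.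
rewrite beta_form_raise// deriv_shifted_jacobi mulNr beta_formN -scalerAl beta_formZ.
have r0 : 0 <= r%:R :> R by [].
by field; rewrite gt_eqF//; lra.
Qed.

Lemma shifted_jacobi_norm_gt0 (R : realType) (r : nat) (a b : R) :
  0 < a -> 0 < b -> 0 < shifted_jacobi_norm r a b.
Proof.
elim: r a b => [|r IHr] a b a0 b0; first by rewrite shifted_jacobi_norm0 beta_gt0.
have r0 : 0 <= r%:R :> R by [].
rewrite shifted_jacobi_normS//; apply: mulr_gt0; last by apply: IHr; lra.
by apply: divr_gt0 => //; lra.
Qed.

(** Stated for r + 1 so that the argument r + a + b of Gamma is positive; at degree 0 it would be a
    + b - 1, possibly a pole. *)
Lemma shifted_jacobi_normE (R : realType) (r : nat) (a b : R) :
  0 < a -> 0 < b ->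
  shifted_jacobi_norm r.+1 a b =
  Gamma (r.+1%:R + a) * Gamma (r.+1%:R + b) /
    ((2 * r%:R + 1 + a + b) * r.+1`!%:R * Gamma (r%:R + a + b)).
Proof.
elim: r a b => [|r IHr] a b a0 b0; rewrite shifted_jacobi_normS//.
  rewrite shifted_jacobi_norm0 /beta mulr0 !add0r.
  have ab0 : 0 < a + b by lra.
  rewrite (_ : a + 1 + (b + 1) = a + b + 1 + 1); last by ring.
  rewrite (GammaD1 (x := a + b + 1)) ?(GammaD1 ab0); last by lra.
  have G0 := Gamma_gt0 ab0; have ab1 : 0 < a + b + 1 by lra.
  have ab1' : 0 < 1 + a + b by lra.
  rewrite [1 + a]addrC [1 + b]addrC factS fact0 muln1.
  by field; do ?[apply/andP; split]; rewrite gt_eqF//; lra.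
have r0 : 0 <= r%:R :> R by [].
rewrite IHr; [|lra..].
rewrite (factS r.+1) natrM -!natr1.
have ab0 : 0 < r%:R + 1 + a + b by lra.
rewrite (_ : r%:R + (a + 1) + (b + 1) = r%:R + 1 + a + b + 1); last by ring.
rewrite (_ : r%:R + 1 + 1 + a = r%:R + 1 + (a + 1)); last by ring.
rewrite (_ : r%:R + 1 + 1 + b = r%:R + 1 + (b + 1)); last by ring.
rewrite (GammaD1 ab0).
have G0 := Gamma_gt0 ab0; have f0 : 0 < r.+1`!%:R :> R by rewrite ltr0n fact_gt0.
have h1 : 0 < 2 * r%:R + 1 + (a + 1) + (b + 1) by lra.
have h2 : 0 < 2 * (r%:R + 1) + 1 + a + b by lra.
have h3 : 0 < r%:R + 1 + 1 :> R by lra.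
by field; do ?[apply/andP; split]; rewrite gt_eqF//; lra.
Qed.

Lemma size_sub_lead (R : fieldType) (n : nat) (p q : {poly R}) :
  size p = n.+1 -> size q = n.+1 ->
  (size (p - (lead_coef p / lead_coef q) *: q)%R <= n)%N.
Proof.
move=> sp sq; apply/leq_sizeP => j; rewrite coefB coefZ leq_eqVlt.
case/predU1P => [<-|nj]; last by rewrite !nth_default ?sp ?sq// mulr0 subr0.
have q0 : lead_coef q != 0 by rewrite lead_coef_eq0 -size_poly_eq0 sq.
have -> : q`_n = lead_coef q by rewrite lead_coefE sq.
by rewrite divfK// lead_coefE sp subrr.
Qed.

(** As Q s has degree exactly s, the first n of them span the polynomials of size at most n, by
    cancelling leading terms. *)
Lemma scalar_poly_span0 (R : fieldType) (F : {poly R} -> R) (Q : nat -> {poly R}) (n : nat) :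
  (forall p q, F (p + q) = F p + F q) -> (forall (c : R) p, F (c *: p) = c * F p) ->
  (forall s, size (Q s) = s.+1) -> (forall s, (s < n)%N -> F (Q s) = 0) ->
  forall p : {poly R}, (size p <= n)%N -> F p = 0.
Proof.
move=> FD FZ sQ; elim: n => [|n IHn] FQ p.
  by rewrite leqn0 size_poly_eq0 => /eqP ->; rewrite -(scale0r 0) FZ mul0r.
rewrite leq_eqVlt => /predU1P[sp|]; last first.
  by apply: IHn => s sn; apply: FQ; rewrite ltnS ltnW.
rewrite -(subrK ((lead_coef p / lead_coef (Q n)) *: Q n) p) FD FZ FQ// mulr0 addr0.
by apply: IHn; [move=> s sn; apply: FQ; rewrite ltnS ltnW|exact: size_sub_lead].
Qed.

(** A nonzero p of degree s is c times the s-th orthogonal polynomial plus lower terms, with c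
    nonzero; testing against that polynomial leaves c times its squared norm. *)
Lemma shifted_jacobi_orthogonal_eq0 (R : realType) (a b : R) (n : nat) (p : {poly R}) :
  0 < a -> 0 < b -> (size p <= n)%N ->
  (forall s, (s < n)%N -> beta_form a b (p * shifted_jacobi s a b) = 0) -> p = 0.
Proof.
move=> a0 b0 pn orth; apply: contraTeq isT => p0; apply/negP => _.
have sp : size p = (size p).-1.+1 by rewrite prednK// lt0n size_poly_eq0.
set s := (size p).-1 in sp.
have sq := size_shifted_jacobi s a0 b0.
have := orth s; rewrite -sp pn => /(_ isT).
set q := shifted_jacobi s a b in sq *.
rewrite -{1}(subrK ((lead_coef p / lead_coef q) *: q) p) mulrDl beta_formD.
rewrite beta_form_shifted_jacobi0 ?size_sub_lead// add0r -scalerAl beta_formZ.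
apply/eqP; rewrite mulf_neq0//; last exact/lt0r_neq0/shifted_jacobi_norm_gt0.
by rewrite mulf_neq0 ?invr_eq0 ?lead_coef_eq0// -size_poly_eq0 sq.
Qed.

Lemma shifted_jacobi_unique (R : realType) (a b : R) (Q : nat -> {poly R}) (r : nat) :
  0 < a -> 0 < b ->
  (forall s, size (Q s) = s.+1) ->
  (forall s, (s < r)%N -> beta_form a b (Q r * Q s) = 0) ->
  (Q r).[0] = (shifted_jacobi r a b).[0] -> Q r = shifted_jacobi r a b.
Proof.
move=> a0 b0 sQ orth Q0; set q := shifted_jacobi r a b in Q0 *.
have sq : size q = r.+1 by exact: size_shifted_jacobi.
set c := lead_coef (Q r) / lead_coef q.
have QrE : Q r = c *: q.
  apply/eqP; rewrite -subr_eq0; apply/eqP.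
  apply: (shifted_jacobi_orthogonal_eq0 a0 b0 (size_sub_lead (sQ r) sq)) => s sr.
  have ss := size_shifted_jacobi s a0 b0.
  rewrite mulrBl beta_formD beta_formN -scalerAl beta_formZ [q * _]mulrC.
  rewrite (@beta_form_shifted_jacobi0 _ r) ?ss// mulr0 subr0.
  (* Orthogonality of Q r to the earlier Q s extends to all polynomials of size at most r, among
     them [shifted_jacobi s a b]. *)
  apply: (@scalar_poly_span0 _ (fun p => beta_form a b (Q r * p)) Q r); rewrite ?ss//.
  - by move=> p p'; rewrite mulrDr beta_formD.
  - by move=> d p; rewrite -scalerAr beta_formZ.
have r0 : 0 <= r%:R :> R by [].
have q0 : 0 < q.[0].
  rewrite horner0_shifted_jacobi//; apply: divr_gt0; first by apply: Gamma_gt0; lra.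
  by apply: mulr_gt0; [rewrite ltr0n fact_gt0|exact: Gamma_gt0].
(* The common value at 0 is nonzero, which fixes the scalar c. *)
rewrite QrE (_ : c = 1) ?scale1r//; apply: (mulIf (lt0r_neq0 q0)).
by rewrite mul1r -hornerZ -QrE.
Qed.

(** * The transformed derivative *)

(** Points of J accumulate at t from the right if t < 1 and from the left if t = 1. Properness makes
    the limits defining the derivatives unique. *)
Lemma punctured_in_J_proper (R : realType) (t : R) : 0 <= t <= 1 ->
  ProperFilter (punctured_in_J t).
Proof.
move=> /andP[t0 t1].
have F : Filter (punctured_in_J t) by exact: within_filter.
apply: Build_ProperFilter => J0.
have {}J0 : \forall s \near t, s != t -> 0 <= s <= 1 -> False.
  exact: J0.
have [tlt1|] := ltP t 1.
  suff: \forall s \near t^'+, False by move=> /filter_ex[].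
  near=> s; have ts : t < s by near: s; exact: nbhs_right_gt.
  have s1 : s < 1 by near: s; exact: nbhs_right_lt.
  have : s != t -> 0 <= s <= 1 -> False.
    by near: s; exact: cvg_within J0.
  by apply; [rewrite gt_eqF|rewrite (le_trans t0 (ltW ts)) ltW].
move=> tge1; suff: \forall s \near t^'-, False by move=> /filter_ex[].
near=> s; have ts : s < t by near: s; exact: nbhs_left_lt.
have s0 : 0 < s by near: s; apply: nbhs_left_gt; rewrite (lt_le_trans _ tge1).
have : s != t -> 0 <= s <= 1 -> False.
  by near: s; exact: cvg_within J0.
by apply; [rewrite lt_eqF|rewrite ltW//= (le_trans (ltW ts))].
Unshelve. all: by end_near. Qed.

Lemma punctured_in_J_itv (R : realType) (t : R) :
  \forall s \near punctured_in_J t, 0 <= s <= 1.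
Proof.
by rewrite /punctured_in_J near_withinE; apply: nearW => s /=; rewrite in_itv.
Qed.

Lemma punctured_in_J_neq (R : realType) (t : R) :
  \forall s \near punctured_in_J t, s != t.
Proof.
by rewrite /punctured_in_J; apply: cvg_within; exact: withinT.
Qed.

Lemma cvg_punctured_in_J (R : realType) (t l : R) (f : R -> R) :
  f s @[s --> t] --> l -> f s @[s --> punctured_in_J t] --> l.
Proof.
by move=> fl; apply: cvg_trans fl; apply: cvg_app; apply: cvg_trans (cvg_within _) (cvg_within _).
Qed.

(** Chain rule in Carathéodory form: p(v) - p(y t) = g(v) (v - y t) with g continuous at y t, so no
    division by y s - y t occurs. *)
Lemma cvg_quotient_wrt_horner (R : realType) (h y : R -> R) (t l : R) (p : {poly R}) :
  y s @[s --> punctured_in_J t] --> y t ->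
  quotient_wrt h y t s @[s --> punctured_in_J t] --> l ->
  quotient_wrt h (fun s => p.[y s]) t s @[s --> punctured_in_J t] --> p^`().[y t] * l.
Proof.
move=> cy cq.
have [g [gE cg <-]] := (is_derive1_caratheodory _ _ _).1 (is_derive_poly p (y t)).
rewrite (_ : quotient_wrt _ _ _ = fun s => g (y s) * quotient_wrt h y t s).
  by apply: cvgM cq; exact: cvg_comp cy cg.
by apply/funext => s; rewrite /quotient_wrt gE mulrA.
Qed.

Lemma cvg_powR_1B (R : realType) (rho t : R) : 0 < rho -> 0 <= t <= 1 ->
  (1 - s) `^ rho @[s --> punctured_in_J t] --> (1 - t) `^ rho.
Proof.
move=> rho0 /andP[t0]; rewrite le_eqVlt => /predU1P[->|t1]; last first.
  apply: cvg_punctured_in_J.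
  apply: (@continuous_comp _ _ _ (fun s : R => 1 - s) (fun u : R => u `^ rho) t).
    by apply: continuousB; [exact: cst_continuous|].
  by apply: continuous_powR; rewrite subr_gt0.
(* At t = 1 the base tends to 0, and the bound is direct: (1 - s)^rho < e as soon as 1 - s <
   e^(1/rho). *)
rewrite subrr powR0 ?gt_eqF//; apply/cvgrPdist_lt => e e0; near=> s.
have s01 : 0 <= s <= 1 by near: s; exact: punctured_in_J_itv.
have s1 : s != 1 by near: s; exact: punctured_in_J_neq.
rewrite sub0r normrN ger0_norm ?powR_ge0//.
have -> : e = (e `^ rho^-1) `^ rho by rewrite -powRrM mulVf ?gt_eqF// powRr1// ltW.
rewrite gt0_ltr_powR ?nnegrE ?powR_ge0//; first by lra.
rewrite ltrBlDr -ltrBlDl; near: s; apply: cvg_within; apply: cvg_within.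
by apply: lt_nbhsr; rewrite gtrBl powR_gt0.
Unshelve. all: by end_near. Qed.

(** The operator acts as - d/dy. Since f is constrained on J only, the result can be fed back in and
    iterated. *)
Lemma tderive_horner (R : realType) (rho t : R) (f : R -> R) (p : {poly R}) :
  0 < rho -> 0 <= t <= 1 ->
  (forall s : R, 0 <= s <= 1 -> f s = p.[(1 - s) `^ rho]) ->
  tderivable rho f t /\ tderive rho f t = - p^`().[(1 - t) `^ rho].
Proof.
move=> rho0 t01 fE; have PF := punctured_in_J_proper t01.
have cy := cvg_powR_1B rho0 t01.
have cf h l : quotient_wrt h (fun s => (1 - s) `^ rho) t s @[s --> punctured_in_J t] --> l ->
    quotient_wrt h f t s @[s --> punctured_in_J t] --> p^`().[(1 - t) `^ rho] * l.
  move=> /(@cvg_quotient_wrt_horner _ _ (fun s => (1 - s) `^ rho) _ _ p cy).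
  apply: cvg_trans; apply: near_eq_cvg; near=> s.
  by rewrite /quotient_wrt !fE//; near: s; exact: punctured_in_J_itv.
rewrite /tderivable /tderive; case: ifPn => [t1|].
  have u0 : 0 < 1 - t by rewrite subr_gt0.
  have Dy : is_derive t (1 : R) (fun s : R => (1 - s) `^ rho) (- (rho * (1 - t) `^ (rho - 1))).
    have := @is_derive1_comp _ _ (fun s => 1 - s) _ _ _ (is_derive1_powR rho u0)
      (is_deriveB (is_derive_cst (1 : R) t 1) (is_derive_id t (1 : R))).
    by rewrite sub0r mulrN1.
  have [g [gE cg gt]] := (is_derive1_caratheodory _ _ _).1 Dy.
  have /cf cq : quotient_wrt id (fun s => (1 - s) `^ rho) t s @[s --> punctured_in_J t] --> g t.
    apply: cvg_trans (cvg_punctured_in_J cg); apply: near_eq_cvg; near=> s.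
    rewrite /quotient_wrt gE mulfK// subr_eq0; near: s; exact: punctured_in_J_neq.
  split; first by apply/cvg_ex; eexists; exact: cq.
  rewrite /derive_wrt (cvg_lim _ cq)// gt.
  (* The prefactor cancels dy/dt = - rho (1 - t)^(rho - 1) up to sign. *)
  have -> : (1 - t) `^ (1 - rho) = ((1 - t) `^ (rho - 1))^-1 by rewrite -powRN opprB.
  have := powR_gt0 (rho - 1) u0 => q0.
  by field; rewrite (gt_eqF q0) (gt_eqF rho0).
rewrite -leNgt => t1; have tE : t = 1 by apply/eqP; rewrite eq_le t1 andbT; case/andP: t01.
(* At t = 1 the derivative is taken with respect to eta = 1 - y, so the quotient for y is constantly
   - 1. *)
have /cf cq : quotient_wrt (Defs.eta rho) (fun s => (1 - s) `^ rho) t s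
    @[s --> punctured_in_J t] --> (- 1 : R).
  apply: cvg_near_cst; near=> s.
  have s01 : 0 <= s <= 1 by near: s; exact: punctured_in_J_itv.
  have st : s != t by near: s; exact: punctured_in_J_neq.
  have s1 : 0 < 1 - s by move: st s01; rewrite tE; lra.
  have := powR_gt0 rho s1 => ys.
  rewrite /quotient_wrt /Defs.eta tE subrr powR0 ?gt_eqF//.
  have -> : 1 - (1 - s) `^ rho - (1 - 0) = - (1 - s) `^ rho by ring.
  by rewrite subr0 invrN mulrN divff// gt_eqF.
split; first by apply/cvg_ex; eexists; exact: cq.
by rewrite /derive_wrt (cvg_lim _ cq)// mulrN1.
Unshelve. all: by end_near. Qed.

Lemma tderiven_horner (R : realType) (rho : R) (f : R -> R) (p : {poly R}) (k : nat) :
  0 < rho -> (forall s : R, 0 <= s <= 1 -> f s = p.[(1 - s) `^ rho]) ->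
  forall t, 0 <= t <= 1 ->
  tderiven rho k f t = ((-1) ^+ k *: p^`(k)).[(1 - t) `^ rho].
Proof.
move=> rho0 fE; elim: k => [|k IHk] t t01; first by rewrite scale1r derivn0 -fE.
have [_ /= ->] := tderive_horner rho0 t01 IHk.
by rewrite derivZ -derivnS exprS mulN1r scaleNr hornerN.
Qed.

Lemma tderivable_tderiven_horner (R : realType) (rho t : R) (f : R -> R)
    (p : {poly R}) (k : nat) :
  0 < rho -> (forall s : R, 0 <= s <= 1 -> f s = p.[(1 - s) `^ rho]) -> 0 <= t <= 1 ->
  tderivable rho (tderiven rho k f) t.
Proof. by move=> rho0 fE t01; have [] := tderive_horner rho0 t01 (tderiven_horner k rho0 fE). Qed.

(** * Identification with the classical Jacobi polynomials *)

Lemma horner_1B2X (R : realType) (y : R) : (1 - 2%:P * 'X).[y] = 1 - 2 * y.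
Proof. by rewrite hornerD hornerN hornerM !hornerC hornerX. Qed.

Lemma integral_jacobi_weightM (R : realType) (mu ups : R) (p q : {poly R}) :
  -1 < mu -> -1 < ups ->
  (\int[@lebesgue_measure R]_(x in `[(-1)%R, 1%R])
     (jacobi_weight mu ups x * p.[x] * q.[x])%:E =
   (2 `^ (mu + ups + 1) * beta_form (mu + 1) (ups + 1)
      ((p \Po (1 - 2%:P * 'X)) * (q \Po (1 - 2%:P * 'X))))%:E)%E.
Proof.
move=> hmu hups; rewrite -integral_jacobi_weight//; apply: eq_integral => x _.
congr EFin; rewrite -mulrA hornerM !horner_comp !horner_1B2X.
by rewrite (_ : 1 - 2 * _ = x)//; field.
Qed.

Lemma jacobi_system_horner (R : realType) (mu ups : R) (Q : nat -> {poly R}) (r : nat) :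
  -1 < mu -> -1 < ups -> is_jacobi_system mu ups Q ->
  Q r \Po (1 - 2%:P * 'X) = shifted_jacobi r (mu + 1) (ups + 1).
Proof.
move=> hmu hups [sQ orth Q1]; have [a0 b0] : 0 < mu + 1 /\ 0 < ups + 1 by split; lra.
apply: (@shifted_jacobi_unique _ _ _ (fun r => Q r \Po (1 - 2%:P * 'X))) => //.
- move=> s; rewrite size_comp_poly2 ?sQ//.
  by rewrite addrC size_polyDl size_polyN size_Cmul ?pnatr_eq0// size_polyX// size_poly1.
- move=> s sr; have rs : r <> s by move=> rs; rewrite rs ltnn in sr.
  have := orth r s rs; rewrite integral_jacobi_weightM// => -[].
  by move/eqP; rewrite mulf_eq0 gt_eqF ?powR_gt0//= => /eqP.
- by rewrite horner_comp horner_1B2X mulr0 subr0 Q1 horner0_shifted_jacobi// addrA.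
Qed.

(** Guarantees that the choice made by [jacobi] is a genuine system and not the default value. *)
Lemma jacobi_system_exists (R : realType) (mu ups : R) :
  -1 < mu -> -1 < ups -> exists Q, is_jacobi_system mu ups Q.
Proof.
move=> hmu hups; have [a0 b0] : 0 < mu + 1 /\ 0 < ups + 1 by split; lra.
(* The inverse of the substitution x = 1 - 2 y. *)
pose phi : {poly R} := 2^-1%:P * (1 - 'X).
have sphi : size phi = 2%N.
  rewrite size_Cmul ?invr_eq0 ?pnatr_eq0// addrC size_polyDl size_polyN size_polyX//.
  by rewrite size_poly1.
have phiK (p : {poly R}) : (p \Po phi) \Po (1 - 2%:P * 'X) = p.
  rewrite -comp_polyA (_ : phi \Po _ = 'X) ?comp_polyXr//.
  rewrite /phi comp_polyM comp_polyB comp_polyX !comp_polyC.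
  by rewrite subKr mulrA -polyCM mulVf ?mul1r// pnatr_eq0.
exists (fun r => shifted_jacobi r (mu + 1) (ups + 1) \Po phi); split.
- by move=> r; rewrite size_comp_poly2// size_shifted_jacobi.
- move=> r s rs; rewrite integral_jacobi_weightM// !phiK.
  have [lt_rs|lt_sr|//] := ltngtP r s.
    by rewrite beta_form_shifted_jacobi0 ?mulr0// size_shifted_jacobi.
  rewrite [X in beta_form _ _ X]mulrC.
  by rewrite beta_form_shifted_jacobi0 ?mulr0// size_shifted_jacobi.
- move=> r; rewrite horner_comp hornerM hornerC hornerD hornerN hornerC hornerX subrr mulr0.
  rewrite horner0_shifted_jacobi//.
  by rewrite addrA.
Qed.

Lemma fjacobiE (R : realType) (mu ups rho t : R) (r : nat) :
  -1 < mu -> -1 < ups ->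
  fjacobi mu ups rho r t = (shifted_jacobi r (mu + 1) (ups + 1)).[(1 - t) `^ rho].
Proof.
move=> hmu hups; have /(xgetPex (fun=> 0)) := jacobi_system_exists hmu hups.
move=> /(jacobi_system_horner r hmu hups) <-.
by rewrite horner_comp horner_1B2X.
Qed.

(** * The constants [dhat] and [hhat] *)

Lemma GammaD1_neq0 (R : realType) (x : R) : -1 < x -> x != 0 ->
  Gamma (x + 1) = x * Gamma x.
Proof.
move=> x1 x0; have [xgt0|xle0] := ltP 0 x; first exact: GammaD1.
(* For - 1 < x < 0 the extension of Gamma takes a single step, dividing by x alone. *)
have trunc0 : Num.truncn (- x) = 0%N by apply: truncn_def; lra.
have xp1 : 0 < x + 1 by lra.
rewrite {2}/Gamma ltNge xle0 /= trunc0 big_ord1 addr0 mulrC divfK//.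
by rewrite /Gamma xp1 addr0 big_ord0 divr1.
Qed.

Lemma Gamma_neq0 (R : realType) (x : R) : -1 < x -> x != 0 -> Gamma x != 0.
Proof.
move=> x1 x0; have : 0 < Gamma (x + 1) by apply: Gamma_gt0; lra.
by rewrite GammaD1_neq0//; apply: contraTneq => ->; rewrite mulr0 ltxx.
Qed.

Lemma dhatS (R : realType) (mu ups : R) (r k : nat) :
  -1 < mu -> -1 < ups -> (k < r)%N ->
  dhat mu ups r k.+1 = (r%:R + k%:R + mu + ups + 1) * dhat mu ups r k.
Proof.
(* Here r >= 1, which excludes the degenerate case and makes r + k + mu + ups + 1 positive. *)
move=> hmu hups kr; rewrite /dhat andbF gtn_eqF ?(leq_ltn_trans _ kr)//=.
have r1 : 1 <= r%:R :> R by rewrite ler1n (leq_ltn_trans _ kr).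
have k0 : 0 <= k%:R :> R by [].
have -> : r%:R + k.+1%:R + mu + ups + 1 = r%:R + k%:R + mu + ups + 1 + 1.
  by rewrite -natr1; ring.
by rewrite GammaD1; [rewrite mulrA|lra].
Qed.

Lemma dhat0 (R : realType) (mu ups : R) (r : nat) :
  -1 < mu -> -1 < ups -> dhat mu ups r 0 = 1.
Proof.
move=> hmu hups; rewrite /dhat/= addr0; case: ifPn => // rx.
(* For r = 0 the argument mu + ups + 1 may be negative, but it exceeds - 1 and is nonzero. *)
rewrite divff//; case: r rx => [|r] rx.
  by rewrite add0r; apply: Gamma_neq0 => //; lra.
have r1 : 1 <= r.+1%:R :> R by rewrite ler1n.
by apply/lt0r_neq0/Gamma_gt0; lra.
Qed.

(** The sign from each differentiation cancels that of - d/dy, and the factor r + k + mu + ups + 1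
    it produces is the ratio of consecutive [dhat]. *)
Lemma derivn_shifted_jacobi (R : realType) (mu ups : R) (r k : nat) :
  -1 < mu -> -1 < ups -> (k <= r)%N ->
  (-1) ^+ k *: (shifted_jacobi r (mu + 1) (ups + 1))^`(k) =
  dhat mu ups r k *: shifted_jacobi (r - k) (mu + k%:R + 1) (ups + k%:R + 1).
Proof.
move=> hmu hups; elim: k => [_|k IHk kr].
  by rewrite derivn0 dhat0// subn0 !addr0.
rewrite derivnS exprS mulN1r scaleNr -derivZ IHk ?(ltnW kr)// derivZ.
have -> : (r - k)%N = (r - k.+1).+1 by rewrite subnSK.
rewrite deriv_shifted_jacobi scalerN opprK scalerA dhatS//.
have -> : mu + k.+1%:R + 1 = mu + k%:R + 1 + 1 by rewrite -natr1; ring.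
have -> : ups + k.+1%:R + 1 = ups + k%:R + 1 + 1 by rewrite -natr1; ring.
by congr (_ *: _); rewrite natrB// -natr1; ring.
Qed.

(** Covers degree 0 as well: there a + b - 1 > 0, and the functional equation rewrites Gamma (a +
    b). *)
Lemma shifted_jacobi_norm_gammaE (R : realType) (r : nat) (a b : R) :
  0 < a -> 0 < b -> 0 < r%:R + a + b - 1 ->
  shifted_jacobi_norm r a b = Gamma (r%:R + a) * Gamma (r%:R + b) /
    ((2 * r%:R + a + b - 1) * r`!%:R * Gamma (r%:R + a + b - 1)).
Proof.
case: r => [|r] a0 b0 rab.
  rewrite shifted_jacobi_norm0 /beta fact0 mulr0 !add0r mulr1.
  move: rab; rewrite add0r => rab; have := GammaD1 rab.
  by rewrite subrK => ->.
rewrite shifted_jacobi_normE// -natr1.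
have -> : r%:R + 1 + a + b - 1 = r%:R + a + b by ring.
by have -> : 2 * (r%:R + 1) + a + b - 1 = 2 * r%:R + 1 + a + b by ring.
Qed.

Lemma hhatE (R : realType) (mu ups : R) (r k : nat) :
  -1 < mu -> -1 < ups -> (k <= r)%N ->
  hhat mu ups r k =
  dhat mu ups r k ^+ 2 * shifted_jacobi_norm (r - k) (mu + k%:R + 1) (ups + k%:R + 1).
Proof.
move=> hmu hups; case: r => [|r] kr.
  (* With r = k = 0 the claim is about beta (mu + 1) (ups + 1), split according to whether mu + ups
     + 1 vanishes. *)
  move: kr; rewrite leqn0 => /eqP ->; rewrite dhat0// expr1n mul1r.
  rewrite shifted_jacobi_norm0 /beta /hhat !addr0 !add0r/=.
  have -> : mu + 1 + (ups + 1) = mu + ups + 1 + 1 by ring.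
  case: ifPn => x0; first by congr (_ / Gamma _); ring.
  have x1 : -1 < mu + ups + 1 by lra.
  have G0 := Gamma_neq0 x1 x0.
  rewrite (GammaD1_neq0 x1 x0) mulr0 fact0 !add0r mulr1.
  by field; rewrite G0.
have r1 : 1 <= r.+1%:R :> R by rewrite ler1n.
have k0 : 0 <= k%:R :> R by [].
(* For r >= 1 the shifted parameters give the positive argument r + k + mu + ups + 1. *)
rewrite shifted_jacobi_norm_gammaE; [|lra|lra|]; last by rewrite natrB//; lra.
rewrite /hhat /dhat/= natrB//.
set n : R := r.+1%:R in r1 *; clearbody n.
have -> : n - k%:R + (mu + k%:R + 1) = n + mu + 1 by ring.
have -> : n - k%:R + (ups + k%:R + 1) = n + ups + 1 by ring.
have -> : n + mu + 1 + (ups + k%:R + 1) - 1 = n + k%:R + mu + ups + 1 by ring.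
have -> : 2 * (n - k%:R) + (mu + k%:R + 1) + (ups + k%:R + 1) - 1 = 2 * n + mu + ups + 1.
  by ring.
have x0 : 0 < n + mu + ups + 1 by lra.
have xk0 : 0 < n + k%:R + mu + ups + 1 by lra.
have G0 := Gamma_gt0 x0; have Gk0 := Gamma_gt0 xk0.
have f0 : 0 < (r.+1 - k)`!%:R :> R by rewrite ltr0n fact_gt0.
have d0 : 0 < 2 * n + mu + ups + 1 by lra.
by field; rewrite (gt_eqF G0) (gt_eqF Gk0) (gt_eqF f0) (gt_eqF d0).
Qed.

Unset Implicit Arguments.

Theorem lemma2p5 (R : realType) (mu ups rho : R) (k r : nat)
    (hmu : -1 < mu) (hups : -1 < ups) (hrho0 : 0 < rho) (hrho1 : rho <= 1)
    (hkr : (k <= r)%N) :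
  [/\ (forall (j : nat) (t : R), (j < k)%N -> 0 <= t <= 1 ->
         tderivable rho (tderiven rho j (fjacobi mu ups rho r)) t),
      (forall t : R, 0 <= t <= 1 ->
         tderiven rho k (fjacobi mu ups rho r) t =
         dhat mu ups r k * fjacobi (mu + k%:R) (ups + k%:R) rho (r - k) t)
    & (forall s : nat,
         (\int[@lebesgue_measure R]_(t in `[0%R, 1%R])
            (varkappa (mu + k%:R) (ups + k%:R) rho t
             * tderiven rho k (fjacobi mu ups rho r) t
             * tderiven rho k (fjacobi mu ups rho s) t)%:E
          = (hhat mu ups r k * (s == r)%:R)%:E)%E)].
Proof.
have k0 : 0 <= k%:R :> R by [].
have hmuk : -1 < mu + k%:R by lra.
have hupsk : -1 < ups + k%:R by lra.
have fE s t (_ : 0 <= t <= 1) := @fjacobiE R mu ups rho t s hmu hups.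
pose P s := (-1) ^+ k *: (shifted_jacobi s (mu + 1) (ups + 1))^`(k).
have DE s t : 0 <= t <= 1 -> tderiven rho k (fjacobi mu ups rho s) t = (P s).[(1 - t) `^ rho].
  exact: tderiven_horner (fE s) _.
split.
- by move=> j t _ t01; apply: (tderivable_tderiven_horner j hrho0 (fE r)).
- move=> t t01; rewrite DE// /P derivn_shifted_jacobi// hornerZ.
  by rewrite -fjacobiE.
move=> s.
transitivity (\int[@lebesgue_measure R]_(t in `[0%R, 1%R])
   (varkappa (mu + k%:R) (ups + k%:R) rho t * (P r * P s).[(1 - t) `^ rho])%:E)%E.
  apply: eq_integral => t; rewrite inE/= in_itv/= => t01.
  by rewrite !DE// hornerM mulrA.
rewrite integral_varkappa//; congr EFin.
(* If s < k the k-th derivative of a polynomial of degree s vanishes, and s differs from r because k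
   <= r. *)
have [sk|ks] := ltnP s k.
  rewrite /P [X in _ * (_ *: X)](_ : _ = 0).
    rewrite scaler0 mulr0 /beta_form size_poly0 big_ord0.
    by rewrite ltn_eqF ?mulr0// (leq_trans sk).
  by apply: derivn_poly0; rewrite size_shifted_jacobi//; lra.
have [a0 b0] : 0 < mu + k%:R + 1 /\ 0 < ups + k%:R + 1 by split; lra.
(* Both factors are now multiples of orthogonal polynomials for the same shifted weight, of degrees
   r - k and s - k; for s <> r the lower degree is tested against the higher. *)
rewrite /P !derivn_shifted_jacobi// -scalerAl -scalerAr scalerA beta_formZ.
have [->|sr] := eqVneq s r; first by rewrite mulr1 hhatE.
rewrite mulr0; have [lt_sr|lt_rs|e] := ltngtP s r; last by rewrite e eqxx in sr.
  rewrite [X in beta_form _ _ X]mulrC beta_form_shifted_jacobi0 ?mulr0//.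
  by rewrite size_shifted_jacobi// ltn_sub2r// (leq_ltn_trans ks).
rewrite beta_form_shifted_jacobi0 ?mulr0//.
by rewrite size_shifted_jacobi// ltn_sub2r// (leq_ltn_trans hkr).
Qed.
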